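(* For every symmetric function $F\in\Lambda_{\mathbb{Q}}$, the quantity $$\Phi_n(F)=\frac{1}{n!}\sum_{\lambda\vdash n} f_\lambda^2\,F(h_u^2 : u\in\lambda)$$ is a polynomial function of $n$ with rational coefficients; that is, there is a polynomial $P_F\in\mathbb{Q}[n]$ such that $\Phi_n(F)=P_F(n)$ for all integers $n\ge 0$.
   Context: $\Lambda_{\mathbb{Q}}$ is the ring of symmetric functions over $\mathbb{Q}$ (formal power series of bounded degree in $x_1,x_2,\dots$, invariant under all permutations of the variables). $\lambda\vdash n$ means that $\lambda$ is a partition of $n$; $u\in\lambda$ means that $u$ is a square of the Young diagram of $\lambda$. $f_\lambda$ is the number of standard Young tableaux of shape $\lambda$. $h_u$ is the hook length of $u$: if $u$ is in row $i$ and column $j$, then $h_u=\lambda_i+\lambda'_j-i-j+1$, where $\lambda'$ is the conjugate partition. $F(h_u^2 : u\in\lambda)$ means: substitute the $n$ quantities $h_u^2$, $u\in\lambda$ (with multiplicity), for $n$ of the variables of $F$ and set all other variables equal to $0$. *)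

(* Defs.v *)
From HB Require Import structures.
From mathcomp Require Import all_boot all_order all_algebra.
From mathcomp Require Import finmap.
From mathcomp Require Import boolp classical_sets functions cardinality fsbigop.

Set Implicit Arguments.
Unset Strict Implicit.
Unset Printing Implicit Defensive.

Import GRing.Theory.

Local Open Scope ring_scope.
Local Open Scope classical_set_scope.

(* Exponent vectors: m stands for the monomial x_0^(m 0) * x_1^(m 1) * ... *)
Notation monom := {fsfun nat -> nat with 0%N}.

Definition mdegree (m : monom) : nat := (\sum_(i <- finsupp m) m i)%N.

(* A formal power series over Q in x_0, x_1, ... is its coefficient function. *)
Notation powser := (monom -> rat).

Definition bounded_degree (F : powser) : Prop :=
  exists d : nat, forall m : monom, (d < mdegree m)%N -> F m = 0.

Definition permutation_invariant (F : powser) : Prop :=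
  forall s : nat -> nat, bijective s ->
  forall m m' : monom, (forall i, m' i = m (s i)) -> F m' = F m.

Definition symmetric_functions : set powser :=
  [set F | bounded_degree F /\ permutation_invariant F].

(* F(a_0, ..., a_(k-1), 0, 0, ...) for a = [:: a_0; ...; a_(k-1)].  Only      *)
(* finitely many terms are nonzero when F has bounded degree; the sum below   *)
(* is over the support of its summand.                                        *)
Definition psubst (F : powser) (a : seq rat) : rat :=
  \sum_(m \in [set: monom]) F m * \prod_(i <- finsupp m) a`_i ^+ m i.

(* Partitions are weakly decreasing sequences of positive integers.           *)
Definition is_partition (n : nat) (la : seq nat) : bool :=
  [&& sorted geq la, all (fun k => 0 < k)%N la & sumn la == n].

(* Rows and columns are numbered from 0. *)
Definition squares (la : seq nat) : seq (nat * nat) :=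
  [seq (i, j) | i <- iota 0 (size la), j <- iota 0 (nth 0%N la i)].

Definition conj_part (la : seq nat) (j : nat) : nat :=
  count (fun k => j < k)%N la.

(* With 0-based coordinates the usual "+ 1" becomes "- 1"; the truncated      *)
(* subtraction is exact on squares of la.                                     *)
Definition hook_length (la : seq nat) (u : nat * nat) : nat :=
  (nth 0 la u.1 + conj_part la u.2 - u.1 - u.2 - 1)%N.

(* Fillings use the entries 0, ..., n - 1 (n = sumn la), each exactly once.   *)
Definition is_SYT (la : seq nat)
    (T : {ffun seq_sub (squares la) -> 'I_(sumn la)}) : bool :=
  [&& [forall k, #|[set u | T u == k]%SET| == 1%N],
      [forall u, forall v,
         ((val u).1 == (val v).1) && ((val u).2 < (val v).2)%N
           ==> (T u < T v)%N]
    & [forall u, forall v,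
         ((val u).2 == (val v).2) && ((val u).1 < (val v).1)%N
           ==> (T u < T v)%N]].

Definition num_SYT (la : seq nat) : nat := #|[set T | @is_SYT la T]%SET|.

Definition hook_squares (la : seq nat) : seq rat :=
  [seq (hook_length la u)%:R ^+ 2 | u <- squares la].

Definition Phi (n : nat) (F : powser) : rat :=
  1 / n`!%:R *
  \sum_(la \in [set la : seq nat | is_partition n la])
     (num_SYT la)%:R ^+ 2 * psubst F (hook_squares la).

(* Main.v *)
Require Import Defs.
From mathcomp Require Import all_boot all_order all_algebra.
From mathcomp Require Import zify ring lra.
From mathcomp Require Import finmap.
From mathcomp Require Import boolp classical_sets fsbigop.

(** Write E_n(g) for the Plancherel average of a function g on partitions:
    the sum of f_la ^ 2 * g(la) / n! over the partitions la of n.  Two facts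
    give the theorem.

    - If g is a shifted symmetric function, that is, a polynomial in the sums
      p_k(la) of the (la_i - i)^k - (- i)^k over the rows i, then E_n(g) is a
      polynomial in n ([plancherel_polynomial]).
    - Every symmetric function of the squares of the hook lengths is shifted
      symmetric ([shifted_sym_psubst]).

    For the first fact, let p_k have weight k + 1.  Removing the cell with the
    largest entry of a tableau expresses f_la as the sum of the f_mu over the
    mu obtained from la by removing a cell ([num_SYT_branching]), so

      E_(n+1)(g) = E_n(h),
      h(mu) = sum over mu + cell of f_(mu+cell) / ((n + 1) f_mu) * g(mu + cell).

    Frobenius' product formula for f_la ([num_SYT_dim_ratio]) identifies
    these ratios: with a_i = mu_i - i, the ratio for row r is the residue at
    z = a_r of the rational function

      prod_j (z - (a_j - 1)) / prod_i (z - a_i),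

    so the ratios add up to 1, and their moments m_k, the sums of the ratios
    times a_r^k, satisfy Newton's identities ([newton_moments]) in terms of
    power sums of the a_i and the a_j - 1.  Hence m_k is shifted symmetric of
    weight k ([wpoly_up_moment]).  Adding a cell of content c changes p_k by
    (c + 1)^k - c^k, of degree k - 1 in c; consequently g(mu + cell) - g(mu) is
    a polynomial in c and the p_k in which the weight has dropped by two, c
    having weight 1.  Averaging turns c^k into m_k, so that E_(n+1)(g) - E_n(g)
    = E_n(h') with h' of weight at least two less than g, and induction on the
    weight concludes.

    For the second fact, the hook lengths of row i of la, together with the
    a_i - a_j for j > i, are the numbers 1, 2, ..., la_i + N - 1 - i, where N
    is the number of rows ([first_row_hooks]).  For an even exponent the sum of
    the (a_i - a_j)^(2k) over i < j is half the sum over all pairs, which is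
    symmetric in the a_i; comparing with the empty partition removes N
    ([hook_power_sum_row_psum]).  So the power sums of the squared hook lengths
    are shifted symmetric.  Finally a symmetric function of bounded degree is
    a fixed combination of augmented monomial symmetric functions, whatever
    the number of variables ([psubst_aug_monomial]), and these are polynomials
    in power sums ([C_aug_monomial]). *)
Set Implicit Arguments.
Unset Strict Implicit.
Unset Printing Implicit Defensive.

Import Order.TTheory GRing.Theory Num.Theory.

(** * Linear extensions of finite relations *)

(** Only the cases #|X| = n are of interest: these are then the linear
    extensions of r, numbered from 0. *)
Definition lin_exts (X : finType) (r : rel X) (n : nat) : {set {ffun X -> 'I_n}} :=
  [set T : {ffun X -> 'I_n} |
     injectiveb T && [forall u, forall v, r u v ==> (T u < T v)%N]]%SET.

Lemma lin_extsP (X : finType) (r : rel X) n (T : {ffun X -> 'I_n}) :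
  reflect (injective T /\ forall u v, r u v -> (T u < T v)%N)
    (T \in lin_exts r n).
Proof.
rewrite inE; apply: (iffP andP) => [[/injectiveP T_inj /forallP Tr]|[T_inj Tr]].
  by split=> // u v; have /forallP/(_ v)/implyP := Tr u.
split; first exact/injectiveP.
by apply/forallP => u; apply/forallP => v; apply/implyP; apply: Tr.
Qed.

Lemma leq_card_lin_exts (X Y : finType) (r : rel X) (s : rel Y) (f : X -> Y) n :
  bijective f -> (forall u v, r u v -> s (f u) (f v)) ->
  (#|lin_exts s n| <= #|lin_exts r n|)%N.
Proof.
move=> f_bij fr; have [g fK gK] := f_bij.
pose h (T : {ffun Y -> 'I_n}) := [ffun x => T (f x)].
have h_inj : injective h.
  move=> T T' /ffunP E; apply/ffunP => y.
  by have := E (g y); rewrite !ffunE gK.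
rewrite -(card_imset _ h_inj); apply/subset_leq_card/fintype.subsetP => _ /imsetP[T /lin_extsP[T_inj Ts] ->].
apply/lin_extsP; split=> [u v|u v /fr /Ts].
  by rewrite !ffunE => /T_inj/(bij_inj f_bij).
by rewrite !ffunE.
Qed.

Lemma card_lin_exts_iso (X Y : finType) (r : rel X) (s : rel Y) (f : X -> Y) n :
  bijective f -> (forall u v, r u v = s (f u) (f v)) ->
  #|lin_exts s n| = #|lin_exts r n|.
Proof.
move=> f_bij fr; have [g fK gK] := f_bij; apply/eqP; rewrite eqn_leq.
rewrite (leq_card_lin_exts _ f_bij) /=; last by move=> u v; rewrite fr.
by apply: (@leq_card_lin_exts _ _ _ _ g) => [|u v]; [exists f|rewrite fr !gK].
Qed.

Section Branching.
Variables (X : finType) (r : rel X) (n : nat).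
Hypothesis cardX : #|X| = n.+1.

Let sub_rel (x : X) : rel {y : X | y != x} := fun u v => r (val u) (val v).

Let ext (x : X) (T : {ffun {y : X | y != x} -> 'I_n}) : {ffun X -> 'I_n.+1} :=
  [ffun y => if insub y is Some z then lift ord_max (T z) else ord_max].

(** A linear extension can put its largest value only at a maximal element,
    and what remains after deleting that element is an arbitrary linear
    extension of the rest. *)
Lemma card_lin_exts_top x :
  #|[set T in lin_exts r n.+1 | T x == ord_max]%SET|
    = (if [forall y, ~~ r x y] then #|lin_exts (@sub_rel x) n| else 0)%N.
Proof.
case: ifPn => [/forallP x_max|]; last first.
  rewrite negb_forall => /existsP[y]; rewrite negbK => rxy.
  apply/eqP; rewrite cards_eq0 -finset.subset0; apply/fintype.subsetP => T.
  rewrite inE => /andP[/lin_extsP[_ /(_ _ _ rxy) Txy] /eqP Tx].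
  by move: Txy; rewrite Tx ltnNge -ltnS ltn_ord.
have ext_x T : @ext x T x = ord_max by rewrite ffunE insubF ?eqxx.
have ext_val T z : @ext x T (val z) = lift ord_max (T z).
  by rewrite ffunE valK.
have ext_inj : injective (@ext x).
  move=> T T' /ffunP E; apply/ffunP => z.
  by have := E (val z); rewrite !ext_val => /lift_inj.
have cases y : y = x \/ exists z : {y : X | y != x}, y = val z.
  have [->|yx] := eqVneq y x; first by left.
  by right; exists (exist _ y yx).
rewrite -(card_imset _ ext_inj); apply: eq_card => T; apply/idP/imsetP.
  rewrite inE => /andP[/lin_extsP[T_inj Tr] /eqP Tx].
  have lt (z : {y : X | y != x}) : (T (val z) < n)%N.
    rewrite ltn_neqAle -ltnS ltn_ord andbT; apply: contra (valP z) => /eqP Tz.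
    by apply/eqP/T_inj/val_inj; rewrite Tx.
  exists [ffun z => Ordinal (lt z)].
    apply/lin_extsP; split=> [u v|u v ruv]; rewrite !ffunE.
      by move=> /(congr1 val) /= /val_inj/T_inj/val_inj.
    exact: Tr.
  apply/ffunP => y; case: (cases y) => [->|[z ->]]; first by rewrite ext_x.
  by apply/ord_inj; rewrite ext_val lift_max ffunE.
case=> T' /lin_extsP[T_inj Tr] ->; rewrite inE ext_x eqxx andbT.
apply/lin_extsP; split=> u v.
  case: (cases u) => [->|[z ->]]; case: (cases v) => [->|[z' ->]] //;
    rewrite ?ext_x ?ext_val.
  - by move/eqP; rewrite (negPf (neq_lift _ _)).
  - by move/eqP; rewrite eq_sym (negPf (neq_lift _ _)).
  - by move=> /lift_inj/T_inj ->.
case: (cases u) => [->|[z ->]]; first by rewrite (negPf (x_max v)).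
case: (cases v) => [->|[z' ->]]; rewrite ?ext_x ?ext_val !lift_max /= => ruv.
  exact: ltn_ord.
exact: Tr.
Qed.

Lemma card_lin_exts_branching :
  #|lin_exts r n.+1|
    = (\sum_(x | [forall y, ~~ r x y]) #|lin_exts (@sub_rel x) n|)%N.
Proof.
rewrite big_mkcond /=; under eq_bigr => x _ do rewrite -card_lin_exts_top.
under eq_bigr => x _ do rewrite -sum1_card.
rewrite (eq_bigr (fun x => \sum_(T in lin_exts r n.+1) (T x == ord_max : nat))%N).
  rewrite exchange_big /= -sum1_card; apply: eq_bigr => T /lin_extsP[T_inj _].
  have /(inj_card_bij T_inj)[g TK gK] : (#|'I_n.+1| <= #|X|)%N.
    by rewrite card_ord cardX.
  rewrite (bigD1 (g ord_max)) //= gK eqxx big1 ?addn0 // => x xg.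
  by case: (T x =P ord_max) xg => // <-; rewrite TK eqxx.
move=> x _; rewrite big_mkcond [RHS]big_mkcond; apply: eq_bigr => T _.
by rewrite inE; case: (T \in _); case: (T x == _).
Qed.

End Branching.

(** The two monotonicity conditions on a tableau compare cells of the same row
    or column only; this relation is not transitive, but its linear extensions
    on a Young diagram are exactly the standard tableaux. *)
Definition same_line_lt : rel (nat * nat) := fun u v =>
  ((u.1 == v.1) && (u.2 < v.2) || (u.2 == v.2) && (u.1 < v.1))%N.

Definition cell_rel (S : seq (nat * nat)) : rel (seq_sub S) :=
  fun u v => same_line_lt (val u) (val v).

Lemma size_squares la : size (squares la) = sumn la.
Proof.
rewrite size_allpairs_dep -[in RHS](mkseq_nth 0 la) /mkseq.
by congr sumn; apply: eq_map => i; rewrite size_iota.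
Qed.

Lemma mem_squares la u : (u \in squares la) = (u.2 < nth 0 la u.1)%N.
Proof.
apply/allpairsPdep/idP => [[i [j [_]]]|lt].
  by rewrite mem_iota /= => lt ->.
exists u.1, u.2; split; last by case: u {lt}.
  rewrite mem_iota /= add0n ltnNge; apply: contraL lt => le.
  by rewrite nth_default.
by rewrite mem_iota.
Qed.

Lemma uniq_squares la : uniq (squares la).
Proof.
apply: allpairs_uniq_dep => [|i _|]; try exact: iota_uniq.
by move=> [i j] [i' j'] _ _ /= [-> ->].
Qed.

Lemma num_SYT_lin_exts la :
  num_SYT la = #|lin_exts (@cell_rel (squares la)) (sumn la)|.
Proof.
apply: eq_card => T; rewrite !inE /is_SYT.
have cardT : (#|'I_(sumn la)| = #|{: seq_sub (squares la)}|)%N.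
  by rewrite card_ord card_seq_sub ?uniq_squares // size_squares.
congr (_ && _).
  apply/forallP/injectiveP => [one u v Tuv|T_inj k].
    have /cards1P[w E] := one (T u).
    have /set1P -> : u \in [set w]%SET by rewrite -E inE.
    by apply/esym/set1P; rewrite -E inE Tuv.
  have [|g TK gK] := inj_card_bij T_inj; first by rewrite cardT.
  apply/cards1P; exists (g k); apply/finset.setP => u; rewrite !inE.
  by apply/eqP/eqP => [<-|->]; rewrite ?TK ?gK.
apply/andP/forallP => [[/forallP rows /forallP cols] u|all_lt].
  apply/forallP => v; apply/implyP => /orP[] uv.
    by have /forallP/(_ v)/implyP/(_ uv) := rows u.
  by have /forallP/(_ v)/implyP/(_ uv) := cols u.
by split; apply/forallP => u; apply/forallP => v; apply/implyP => uv;
  have /forallP/(_ v)/implyP := all_lt u; apply; rewrite /cell_rel /same_line_lt uv ?orbT.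
Qed.

(** * Adding and removing cells *)

Lemma big_pred1_seq (R : Type) (idx : R) (op : Monoid.law idx) (I : eqType)
    (r : seq I) (i : I) (F : I -> R) : uniq r ->
  \big[op/idx]_(j <- r | j == i) F j = if i \in r then F i else idx.
Proof.
move=> r_uniq; rewrite -big_filter; case: ifP => ir.
  by rewrite filter_pred1_uniq // big_seq1.
rewrite big1_seq // => j /=; rewrite mem_filter => /andP[/eqP-> ].
by rewrite ir.
Qed.

Lemma is_partitionP n la :
  reflect [/\ forall i, nth 0 la i.+1 <= nth 0 la i,
              forall i, i < size la -> 0 < nth 0 la i & sumn la = n]%N
    (is_partition n la).
Proof.
apply: (iffP and3P) => [[/(sortedP 0) la_dec /(all_nthP 0) la_pos /eqP]|[la_dec la_pos <-]].
  split=> // i; case: (ltnP i.+1 (size la)) => [/la_dec //|le].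
  by rewrite nth_default.
by split=> //; [apply/(sortedP 0) => i _; apply: la_dec|apply/(all_nthP 0)].
Qed.

Lemma partition_nth_le n la i j :
  is_partition n la -> (i <= j)%N -> (nth 0 la j <= nth 0 la i)%N.
Proof.
case/is_partitionP=> la_dec _ _; elim: j => [|j IH]; first by rewrite leqn0 => /eqP->.
by rewrite leq_eqVlt => /predU1P[-> //|/IH]; apply: leq_trans.
Qed.

Lemma partition_nth_gt0 n la i :
  is_partition n la -> (0 < nth 0 la i)%N = (i < size la)%N.
Proof.
case/is_partitionP=> _ la_pos _; apply/idP/idP => [|/la_pos //].
by apply: contraTT; rewrite -!leqNgt => le; rewrite nth_default.
Qed.

Lemma eq_partition n n' la mu :
  is_partition n la -> is_partition n' mu -> nth 0 la =1 nth 0 mu -> la = mu.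
Proof.
move=> Pla Pmu E; have szE i : (i < size la) = (i < size mu).
  by rewrite -(partition_nth_gt0 _ Pla) -(partition_nth_gt0 _ Pmu) E.
apply: (@eq_from_nth _ 0) => [|i _]; last exact: E.
by have := szE (size la); have := szE (size mu); rewrite !ltnn; lia.
Qed.

Lemma size_partition n la : is_partition n la -> (size la <= n)%N.
Proof.
case/and3P=> _ + /eqP<-; elim: la => //= k la IH /andP[k0 /IH]; lia.
Qed.

Definition removable (la : seq nat) i := (nth 0 la i.+1 < nth 0 la i)%N.

(** The case distinction keeps all parts positive: a removable row of length 1
    is the last row, which then disappears. *)
Definition decr_nth (la : seq nat) i :=
  if nth 0 la i == 1%N then take i la else set_nth 0 la i (nth 0 la i).-1.

Lemma sumn_incr_nth la i : sumn (incr_nth la i) = (sumn la).+1.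
Proof.
elim: la i => [|k la IH] [|i] //=; last by rewrite IH addnS.
by rewrite -cat_nseq sumn_cat sumn_nseq.
Qed.

Section Remove.
Variables (n : nat) (la : seq nat) (i : nat).
Hypotheses (Pla : is_partition n la) (la_i : removable la i).

Let i_lt : (i < size la)%N.
Proof. by rewrite -(partition_nth_gt0 _ Pla); apply: leq_ltn_trans la_i. Qed.

Let size_la : nth 0 la i = 1%N -> size la = i.+1.
Proof.
move=> la_i1; apply/eqP; rewrite eqn_leq i_lt andbT leqNgt.
by rewrite -(partition_nth_gt0 _ Pla) -leqNgt -ltnS -la_i1.
Qed.

Lemma nth_decr_nth j : nth 0 (decr_nth la i) j = (nth 0 la j - (j == i))%N.
Proof.
rewrite /decr_nth; case: eqP => [la_i1|_]; last first.
  by rewrite nth_set_nth /=; case: eqP => [->|_]; rewrite (subn1, subn0).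
case: (ltngtP j i) => [ji|ij|->]; first by rewrite nth_take // subn0.
  by rewrite !nth_default ?size_take ?i_lt ?size_la // ltnW.
by rewrite la_i1 nth_default // size_take i_lt.
Qed.

Lemma decr_nthK : incr_nth (decr_nth la i) i = la.
Proof.
apply: (@eq_from_nth _ 0) => [|j _]; last first.
  rewrite nth_incr_nth nth_decr_nth eq_sym; case: eqP => [->|_]; last by rewrite subn0.
  by rewrite subnKC // (leq_ltn_trans _ la_i).
rewrite size_incr_nth /decr_nth; case: eqP => [/size_la E|_].
  by rewrite size_take i_lt ltnn E.
by rewrite size_set_nth (maxn_idPr i_lt) i_lt.
Qed.

Lemma is_partition_decr : is_partition n.-1 (decr_nth la i).
Proof.
apply/is_partitionP; split=> [j|j|].
- rewrite !nth_decr_nth; have := partition_nth_le Pla (leqnSn j).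
  by have := la_i; rewrite /removable; case: (j =P i) => [->|_] /=; lia.
- rewrite nth_decr_nth /decr_nth; case: ifP => [_|la_i1].
    rewrite size_take i_lt => ji; rewrite ltn_eqF // subn0.
    by rewrite (partition_nth_gt0 _ Pla) (ltn_trans ji i_lt).
  rewrite size_set_nth (maxn_idPr i_lt) -(partition_nth_gt0 _ Pla).
  by move: la_i1 la_i; rewrite /removable; case: (j =P i) => [->|_]; lia.
by case/is_partitionP: Pla => _ _ <-; rewrite -{2}decr_nthK sumn_incr_nth.
Qed.

Lemma size_decr_nth : (size (decr_nth la i) <= size la)%N.
Proof. by rewrite -{2}decr_nthK size_incr_nth; case: ltnP => // /leq_trans; apply. Qed.

Lemma mem_squares_decr u :
  (u \in squares (decr_nth la i))
    = (u \in squares la) && (u != (i, (nth 0 la i).-1)).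
Proof.
case: u => a b; rewrite !mem_squares /= nth_decr_nth xpair_eqE.
by case: (a =P i) la_i => [->|_]; rewrite /removable; lia.
Qed.

End Remove.

(** The covering relation of Young's lattice seen from above and from below;
    this is what lets sums over pairs of neighbours be exchanged. *)
Lemma incr_nth_removable n la mu i :
  is_partition n la -> is_partition n.-1 mu ->
  (incr_nth mu i == la) = removable la i && (mu == decr_nth la i).
Proof.
move=> Pla Pmu; apply/eqP/andP => [E|[la_i /eqP->]]; last exact: decr_nthK Pla la_i.
have la_i : removable la i.
  rewrite /removable -E !nth_incr_nth eqxx (ltn_eqF (ltnSn i)) add0n add1n ltnS.
  exact: partition_nth_le Pmu _.
split=> //; apply/eqP/(eq_partition Pmu (is_partition_decr Pla la_i)) => j.
by rewrite (nth_decr_nth Pla la_i) -E nth_incr_nth eq_sym addKn.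
Qed.

Lemma maximal_square n la (u : seq_sub (squares la)) :
  is_partition n la ->
  [forall v, ~~ @cell_rel (squares la) u v]
    = removable la (val u).1 && ((val u).2 == (nth 0 la (val u).1).-1).
Proof.
move=> Pla; case: u => -[i j] uP /=; have := uP; rewrite mem_squares /= => lt.
apply/forallP/andP => [u_max|[]].
  have max k l : (l < nth 0 la k)%N -> ~~ same_line_lt (i, j) (k, l).
    by move=> lt'; have := u_max (SeqSub (_ : (k, l) \in squares la)); apply; rewrite mem_squares.
  split; last by have := max i j.+1; rewrite /same_line_lt /=; lia.
  by have := max i.+1 j; have := max i j.+1; rewrite /same_line_lt /removable /=; lia.
rewrite /removable => la_i /eqP jE [[k l] vP]; have := vP.
rewrite mem_squares /cell_rel /same_line_lt /= => lt'; apply/norP; split.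
  by apply/negP => /andP[/eqP ik]; move: lt'; rewrite -ik; lia.
apply/negP => /andP[/eqP jl ik]; have := partition_nth_le Pla ik; lia.
Qed.

Lemma card_lin_exts_cells (S S' : seq (nat * nat)) (u : seq_sub S) n :
  (forall v, (v \in S') = (v \in S) && (v != val u)) ->
  #|lin_exts (fun a b : {y : seq_sub S | y != u} => cell_rel (val a) (val b)) n|
    = #|lin_exts (@cell_rel S') n|.
Proof.
move=> memS'.
have to_S (v : seq_sub S') : val v \in S by have := valP v; rewrite memS' => /andP[].
have to_neq (v : seq_sub S') : SeqSub (to_S v) != u.
  by have := valP v; rewrite memS' => /andP[].
have to_S' (v : {y : seq_sub S | y != u}) : val (val v) \in S'.
  by rewrite memS' (valP (val v)) (valP v).
pose f v : {y : seq_sub S | y != u} := exist _ (SeqSub (to_S v)) (to_neq v).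
apply: (@card_lin_exts_iso _ _ _ _ f) => //.
by exists (fun v => SeqSub (to_S' v)) => v; [|apply: val_inj]; apply: val_inj.
Qed.

Lemma big_seq_sub (S : seq (nat * nat)) (P : pred (nat * nat)) h : uniq S ->
  (\sum_(u : seq_sub S | P (val u)) h (val u) = \sum_(v <- S | P v) h v)%N.
Proof.
move=> S_uniq; rewrite -(big_map val P h); apply/perm_big/uniq_perm => //.
  by rewrite map_inj_uniq ?index_enum_uniq //; apply: val_inj.
move=> v; apply/mapP/idP => [[u _ ->]|vS]; first exact: valP.
by exists (SeqSub vS); rewrite ?mem_index_enum.
Qed.

(** The largest entry of a standard tableau sits in a corner, and removing it
    leaves a standard tableau of the smaller shape.  The bound N on the number
    of rows is free, so that one N can serve for several shapes. *)
Lemma num_SYT_branching n N la :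
  is_partition n.+1 la -> (size la <= N)%N ->
  num_SYT la = (\sum_(i < N | removable la i) num_SYT (decr_nth la i))%N.
Proof.
move=> Pla szN; have /is_partitionP[_ _ sumla] := Pla.
have card_sq : #|{: seq_sub (squares la)}| = n.+1.
  by rewrite card_seq_sub ?uniq_squares // size_squares.
rewrite num_SYT_lin_exts sumla card_lin_exts_branching //.
under eq_bigl => u do rewrite (maximal_square _ Pla).
pose h (u : nat * nat) := num_SYT (decr_nth la u.1).
pose P (u : nat * nat) := removable la u.1 && (u.2 == (nth 0 la u.1).-1).
rewrite (eq_bigr (fun u => h (val u))) => [|u]; last first.
  move=> /andP[la_i /eqP u2]; rewrite /h num_SYT_lin_exts.
  have /is_partitionP[_ _ ->] := is_partition_decr Pla la_i.
  apply: card_lin_exts_cells => v.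
  by rewrite (mem_squares_decr Pla la_i) -u2; case: (val u).
rewrite (big_seq_sub P h (uniq_squares la)) big_mkcond /= big_allpairs_dep.
rewrite [RHS]big_mkcond /= -(big_mkord xpredT
  (fun i => if removable la i then num_SYT (decr_nth la i) else 0)%N).
rewrite (big_cat_nat (leq0n _) szN) /= [X in (_ + X)%N]big_nat_cond.
rewrite [X in (_ + X)%N]big1 ?addn0 => [|i]; last first.
  by rewrite /removable => /andP[/andP[le _] _]; rewrite !nth_default // ltnW.
rewrite /index_iota subn0; apply: eq_bigr => i _; rewrite /P /h /=.
case: ifP => [la_i|_]; last by rewrite big1.
rewrite -big_mkcond big_pred1_seq ?iota_uniq //= mem_iota ifT //.
by move: la_i; rewrite /removable; lia.
Qed.

Local Open Scope ring_scope.

(** * Enumerating partitions *)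

(** Grown cell by cell; increasing some rows leaves the set of partitions,
    hence the filter. *)
Fixpoint partitions n : seq (seq nat) :=
  if n is m.+1 then
    [seq la <- undup [seq incr_nth mu i | mu <- partitions m, i <- iota 0 n]
       | is_partition n la]
  else [:: [::]].

Lemma partitions_uniq n : uniq (partitions n).
Proof. by case: n => //= n; rewrite filter_uniq ?undup_uniq. Qed.

Lemma mem_partitions n la : (la \in partitions n) = is_partition n la.
Proof.
elim: n la => [|n IH] la.
  rewrite inE; apply/eqP/idP => [->|/size_partition] //.
  by rewrite leqn0 => /nilP.
rewrite mem_filter mem_undup andb_idr // => Pla.
have la_gt0 : (0 < size la)%N by case: la Pla.
set i := (size la).-1.
have la_i : removable la i.
  by rewrite /removable prednK // nth_default // (partition_nth_gt0 _ Pla) prednK.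
apply/allpairsP; exists (decr_nth la i, i); rewrite IH mem_iota /=; split.
- exact: is_partition_decr Pla la_i.
- by rewrite add0n prednK //; apply: size_partition.
by rewrite (decr_nthK Pla).
Qed.

Arguments partitions : simpl never.

Lemma fsbig_partitions n (F : seq nat -> rat) :
  \sum_(la \in [set la : seq nat | is_partition n la]%classic) F la
    = \sum_(la <- partitions n) F la.
Proof.
rewrite (fsbig_seq _ _ (partitions_uniq n)); apply: eq_fsbigl.
by apply/seteqP; split=> la /=; rewrite mem_partitions.
Qed.

(** Expanding f_la by the branching rule and summing over the smaller shape
    first: a sum over level n + 1 of Young's lattice becomes a sum over level
    n of sums over the ways to add a cell. *)
Lemma sum_SYT_exchange n N (G : seq nat -> rat) : (n < N)%N ->
  \sum_(la <- partitions n.+1) (num_SYT la)%:R * G la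
    = \sum_(mu <- partitions n) (num_SYT mu)%:R *
        \sum_(i < N | is_partition n.+1 (incr_nth mu i)) G (incr_nth mu i).
Proof.
move=> nN; transitivity (\sum_(la <- partitions n.+1) \sum_(i < N)
    \sum_(mu <- partitions n | incr_nth mu i == la) (num_SYT mu)%:R * G la).
  rewrite [LHS]big_seq [RHS]big_seq; apply: eq_bigr => la; rewrite mem_partitions => Pla.
  have szla : (size la <= N)%N := leq_trans (size_partition Pla) nN.
  rewrite (num_SYT_branching Pla szla) natr_sum mulr_suml big_mkcond /=.
  apply: eq_bigr => i _; rewrite [RHS]big_seq_cond.
  under eq_bigl => mu do rewrite mem_partitions.
  case: ifP => [la_i|not_la_i]; last first.
    rewrite big1 // => mu /andP[Pmu].
    by rewrite (incr_nth_removable _ Pla Pmu) not_la_i.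
  rewrite (eq_bigl (pred1 (decr_nth la i))) => [|mu] /=.
    rewrite big_pred1_seq ?partitions_uniq // mem_partitions ifT //.
    exact: is_partition_decr Pla la_i.
  apply/andP/eqP => [[Pmu]|->].
    by rewrite (incr_nth_removable _ Pla Pmu) => /andP[_ /eqP].
  by rewrite (decr_nthK Pla la_i) (is_partition_decr Pla la_i).
rewrite exchange_big /=.
under eq_bigr => i _ do rewrite (exchange_big_dep predT) //=.
rewrite exchange_big /=; apply: eq_bigr => mu _.
rewrite mulr_sumr [RHS]big_mkcond /=; apply: eq_bigr => i _.
under eq_bigl => la do rewrite eq_sym.
rewrite big_pred1_seq ?partitions_uniq //.
by rewrite mem_partitions; case: ifP; rewrite ?mulr0.
Qed.

(** * Lagrange weights and Newton's identities for their moments *)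

Lemma exprD1_sub (c : rat) k :
  (c + 1) ^+ k - c ^+ k = \sum_(l < k) 'C(k, l)%:R * c ^+ l.
Proof.
rewrite addrC (addrC c) exprDn big_ord_recr /= subnn expr0 mul1r binn mulr1n.
rewrite addrC addrK; apply: eq_bigr => l _.
by rewrite expr1n mul1r mulr_natl.
Qed.

(** The powers x^(d+1) have differences with leading term (d + 1) x^d, so the
    leading term of P can be removed at each step. *)
Lemma antidifference (P : {poly rat}) :
  exists Q : {poly rat}, forall x : rat, Q.[x + 1] - Q.[x] = P.[x].
Proof.
have [n] := ubnP (size P); elim: n P => // n IHn P szP.
have [->|P0] := eqVneq P 0; first by exists 0 => x; rewrite !horner0 subrr.
set d := (size P).-1.
have szPd : size P = d.+1 by rewrite prednK // size_poly_gt0.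
(* S collects the lower order terms of the difference of x^(d+1). *)
pose S : {poly rat} := \poly_(i < d) ('C(d.+1, i)%:R).
have XS x : (x + 1) ^+ d.+1 - x ^+ d.+1 = d.+1%:R * x ^+ d + S.[x].
  by rewrite exprD1_sub big_ord_recr /= binSn addrC horner_poly.
pose c := lead_coef P / d.+1%:R.
have d0 : d.+1%:R != 0 :> rat by rewrite pnatr_eq0.
have [|Q HQ] := IHn (P - lead_coef P *: 'X^d - c *: S).
  rewrite -ltnS; apply: leq_trans szP; rewrite szPd ltnS.
  apply/leq_sizeP => j dj; rewrite !coefB !coefZ coefXn coef_poly ltnNge dj mulr0 subr0.
  have [->|jd] := eqVneq j d; first by rewrite mulr1 lead_coefE subrr.
  by rewrite mulr0 subr0 nth_default // szPd ltn_neqAle eq_sym jd.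
exists (Q + c *: 'X^(d.+1)) => x.
rewrite !hornerD !hornerZ !hornerXn opprD addrACA HQ -mulrBr XS.
rewrite !hornerD !hornerN !hornerZ hornerXn mulrDr mulrA divfK //; ring.
Qed.

Lemma poly_eq0_nat (P : {poly rat}) :
  (forall n, P.[n.+1%:R] = 0) -> P = 0.
Proof.
move=> P0; apply/(@roots_geq_poly_eq0 _ _ [seq n.+1%:R | n <- iota 0 (size P)]).
- by apply/allP => _ /mapP[n _ ->]; rewrite rootE P0.
- rewrite map_inj_uniq ?iota_uniq // => m n /eqP.
  by rewrite eqr_nat eqSS => /eqP.
- by rewrite size_map size_iota.
Qed.

Section Moments.
Variables (N : nat) (x : 'I_N.+1 -> rat) (y : 'I_N -> rat).

(** The residue at z = x i of prod_j (z - y j) / prod_l (z - x l). *)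
Definition weight i := (\prod_j (x i - y j)) / \prod_(l | l != i) (x i - x l).
Definition moment k := \sum_i weight i * x i ^+ k.
Definition psum_diff k := \sum_i x i ^+ k - \sum_j y j ^+ k.

Hypothesis x_inj : injective x.

(** Both sides have degree at most N in z and agree at the N + 1 points x i. *)
Lemma lagrange z :
  \sum_i weight i * \prod_(l | l != i) (z - x l) = \prod_j (z - y j).
Proof.
pose L := \sum_i weight i *: \prod_(l | l != i) ('X - (x l)%:P).
pose Y := \prod_j ('X - (y j)%:P).
have EL u : L.[u] = \sum_i weight i * \prod_(l | l != i) (u - x l).
  rewrite horner_sum; apply: eq_bigr => i _; rewrite hornerZ horner_prod.
  by congr (_ * _); apply: eq_bigr => l _; rewrite hornerXsubC.
have EY u : Y.[u] = \prod_j (u - y j).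
  by rewrite horner_prod; apply: eq_bigr => l _; rewrite hornerXsubC.
rewrite -EL -EY; congr (_.[_]).
apply/eqP; rewrite -subr_eq0; apply/eqP.
apply: (@roots_geq_poly_eq0 _ _ [seq x i | i <- enum 'I_N.+1]).
- apply/allP => _ /mapP[i _ ->]; rewrite rootE hornerD hornerN EL EY subr_eq0.
  rewrite (bigD1 i) //= [X in _ + X]big1 ?addr0 => [|l li].
    rewrite /weight divfK //; apply/prodf_neq0 => l li.
    by rewrite subr_eq0; apply: contra li => /eqP/x_inj->.
  by rewrite [X in _ * X](bigD1 i) 1?eq_sym //= subrr mul0r mulr0.
- by rewrite map_inj_uniq ?enum_uniq.
rewrite size_map size_enum_ord.
apply: leq_trans (size_polyD _ _) _; rewrite size_polyN geq_max; apply/andP; split.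
  apply: leq_trans (size_sum _ _ _) _; apply/bigmax_leqP => i _.
  apply: leq_trans (size_scale_leq _ _) _.
  by rewrite -big_filter size_prod_XsubC -sum1_size big_filter sum1_card cardC1 card_ord.
by rewrite size_prod_XsubC /index_enum -enumT size_enum_ord.
Qed.

(** The substitution z = 1 / t, which prepares for expansions at infinity. *)
Lemma lagrange_rev :
  \sum_i weight i *: \prod_(l | l != i) (1 - x l *: 'X)
    = \prod_j (1 - y j *: 'X) :> {poly rat}.
Proof.
apply/eqP; rewrite -subr_eq0; apply/eqP; apply: poly_eq0_nat => n.
set t : rat := n.+1%:R.
have t0 : t != 0 by rewrite pnatr_eq0.
have E (I : finType) (P : pred I) (f : I -> rat) :
    (\prod_(l | P l) (1 - f l *: 'X)).[t]
      = t ^+ #|P| * \prod_(l | P l) (t^-1 - f l).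
  rewrite horner_prod -prodr_const -big_split /=; apply: eq_bigr => l _.
  by rewrite hornerD hornerN hornerZ hornerX hornerC mulrBr mulfV // mulrC.
rewrite hornerD hornerN E horner_sum card_ord.
rewrite -lagrange mulr_sumr -sumrB big1 // => i _.
by rewrite hornerZ E cardC1 card_ord /= mulrCA subrr.
Qed.

End Moments.

Lemma geometric_mod K (c : rat) :
  (1 - c *: 'X) * (\poly_(k < K) c ^+ k) = 1 - c ^+ K *: 'X^K :> {poly rat}.
Proof.
have -> : \poly_(k < K) c ^+ k = \sum_(k < K) (c *: 'X : {poly rat}) ^+ k.
  by rewrite poly_def; apply: eq_bigr => k _; rewrite exprZn.
by rewrite -[LHS]opprK -mulNr opprB -subrX1 exprZn opprB.
Qed.

(** The identity t X' / X = - sum_i (x i t + x i^2 t^2 + ...) for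
    X = prod_i (1 - x i t), truncated and cleared of denominators. *)
Lemma log_derivative_mod K (I : finType) (x : I -> rat) :
  let X := \prod_i (1 - x i *: 'X) : {poly rat} in
  'X^K %| X * \sum_i (\poly_(k < K) x i ^+ k - 1) + 'X * X^`().
Proof.
rewrite /=; elim/big_rec2: _ => [|i P X _ IH].
  by rewrite mulr0 derivC mulr0 addr0 dvdp0.
have -> : ((1 - x i *: 'X) * X)^`()
    = - (x i)%:P * X + (1 - x i *: 'X) * X^`() :> {poly rat}.
  by rewrite derivM derivB derivC derivZ derivX sub0r alg_polyC.
set g := \poly_(k < K) _; have gE := geometric_mod K (x i).
have -> : (1 - x i *: 'X) * X * (g - 1 + P)
      + 'X * (- (x i)%:P * X + (1 - x i *: 'X) * X^`())
    = (1 - x i *: 'X) * (X * P + 'X * X^`()) - X * (x i ^+ K)%:P * 'X^K.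
  move: gE; rewrite -/g -!mul_polyC; move: ((x i ^+ K)%:P) ('X^K) => c u gE.
  have -> : X * c * u = X * (1 - (1 - (x i)%:P * 'X) * g) by rewrite gE; ring.
  by move: g {gE} => g; ring.
by rewrite dvdp_addl ?dvdp_mull // dvdpNr dvdp_mull.
Qed.

Section Newton.
Variables (N : nat) (x : 'I_N.+1 -> rat) (y : 'I_N -> rat).
Hypothesis x_inj : injective x.

Let X := \prod_i (1 - x i *: 'X) : {poly rat}.
Let Y := \prod_i (1 - y i *: 'X) : {poly rat}.
Let M K := \poly_(k < K) moment x y k.

(** The series sum_k (moment k) t^k equals Y / X, modulo t^K. *)
Lemma moments_mod K : 'X^K %| X * M K - Y.
Proof.
have -> : M K = \sum_i weight x y i *: \poly_(k < K) x i ^+ k.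
  apply/polyP => k; rewrite coef_poly coef_sum; case: ifP => kK.
    by apply: eq_bigr => i _; rewrite coefZ coef_poly kK.
  by rewrite big1 // => i _; rewrite coefZ coef_poly kK mulr0.
rewrite /Y -(lagrange_rev _ x_inj) mulr_sumr -sumrB.
apply: (big_ind (fun p => 'X^K %| p)) => [||i _]; [exact: dvdp0|exact: dvdp_add|].
rewrite /X (bigD1 i) //= -scalerAr -scalerBr mulrAC geometric_mod.
by rewrite mulrBl mul1r addrC addKr scalerN dvdpNr -!mul_polyC mulrA dvdp_mulr ?dvdp_mull.
Qed.

Lemma moment0 : moment x y 0 = 1.
Proof.
have /dvdpP[D] := moments_mod 1; rewrite expr1 => /(congr1 (fun p => p.[0])).
rewrite !(hornerD, hornerN, hornerM) hornerX mulr0 => /eqP; rewrite subr_eq0.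
have E (I : finType) (f : I -> rat) : (\prod_i (1 - f i *: 'X)).[0] = 1.
  rewrite horner_prod big1 // => i _.
  by rewrite !(hornerD, hornerN, hornerZ) hornerC hornerX mulr0 subr0.
by rewrite !E mul1r => /eqP <-; rewrite horner_coef0 coef_poly.
Qed.

(** With M = Y / X one has t M' / M = t Y' / Y - t X' / X, which is the series
    of the differences of power sums; comparing coefficients of t^k in
    t M' = (t Y' / Y - t X' / X) M gives the identity.  Everything is done
    modulo t^(k+1), where X is invertible. *)
Lemma newton_moments k :
  k%:R * moment x y k
    = \sum_(j < k) psum_diff x y j.+1 * moment x y (k - j.+1).
Proof.
(* The coefficient of t^k is the last one that survives modulo t^K. *)
set K := k.+1.
pose P (I : finType) (f : I -> rat) : {poly rat} :=
  \sum_i (\poly_(k < K) f i ^+ k - 1).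
set Q := P _ x - P _ y.
have cop : coprimep 'X^K X.
  apply: coprimep_expl; rewrite coprimep_sym -['X]subr0 -polyC0 coprimep_XsubC.
  rewrite rootE /X horner_prod prodf_seq_neq0; apply/allP => i _ /=.
  by rewrite !(hornerD, hornerN, hornerZ) hornerC hornerX mulr0 subr0 oner_eq0.
have D : 'X^K %| 'X * (M K)^`() - Q * M K.
  rewrite -(Gauss_dvdpr _ cop).
  have /dvdpP[R HR] := moments_mod K.
  have DX := log_derivative_mod K x; have DY := log_derivative_mod K y.
  rewrite /= -/X -/Y -/(P _ x) -/(P _ y) in DX DY.
  have DR : 'X^K %| 'X * (X * M K - Y)^`().
    have -> : 'X * (X * M K - Y)^`() = ('X * R^`() + R *+ K) * 'X^K.
      rewrite HR derivM derivXn mulrDl mulrDr mulrA; congr (_ + _).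
      by rewrite /= mulrnAr mulrnAr mulrCA -exprS mulrnAl.
    exact: dvdp_mull.
  have -> : X * ('X * (M K)^`() - Q * M K)
      = 'X * (X * M K - Y)^`() + ('X * Y^`() + Y * P _ y)
        - (X * P _ x + 'X * X^`()) * M K + P _ y * (X * M K - Y).
    by rewrite derivB derivM /Q; ring.
  rewrite dvdp_add ?dvdp_mull // ?moments_mod // dvdp_sub ?dvdp_mulr //.
  by rewrite dvdp_add // addrC.
have PE (I : finType) (f : I -> rat) j : (P I f)`_j
    = if (0 < j < K)%N then \sum_i f i ^+ j else 0.
  rewrite coef_sum; case: ifP => [/andP[j0 jK]|jK].
    by apply: eq_bigr => i _; rewrite coefB coef_poly jK coef1 gtn_eqF // subr0.
  rewrite big1 // => i _; rewrite coefB coef_poly coef1.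
  by case: j jK => [_|j /= ->]; rewrite ?expr0 subrr.
case/dvdpP: D => R /(congr1 (coefp k)).
rewrite /coefp coefMXn ltnSn coefB => /eqP; rewrite subr_eq0 => /eqP.
move=> E; transitivity ((Q * M K)`_k); last first.
  rewrite coefM big_ord_recl /= coefB !PE subrr mul0r add0r.
  apply: eq_bigr => j _; rewrite coefB !PE /= /bump /= add1n ltnS ltn_ord.
  by rewrite coef_poly ltnS leq_subr.
rewrite -E coefXM /M /K; case: (k) => [|l] /=; first by rewrite mul0r.
by rewrite coef_deriv coef_poly ltnSn mulr_natl.
Qed.

End Newton.

(** * The proportion of standard tableaux among all fillings *)

(** Changing one argument of a Vandermonde product multiplies it by the ratios
    of the factors that involve this argument; the signs of these factors
    cancel in the ratios. *)
Lemma vandermonde_update N (u v : 'I_N -> rat) (r : 'I_N) :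
  injective v -> (forall i, i != r -> u i = v i) ->
  \prod_(i < N) \prod_(j < N | (i < j)%N) (u i - u j)
    = \prod_(i < N) \prod_(j < N | (i < j)%N) (v i - v j)
      * \prod_(j < N | j != r) ((u r - v j) / (v r - v j)).
Proof.
move=> v_inj uv; pose rho j := (u r - v j) / (v r - v j).
have vB i j : i != j -> v i - v j != 0.
  by move=> ij; rewrite subr_eq0; apply: contra ij => /eqP/v_inj->.
have E (i j : 'I_N) : (i < j)%N -> u i - u j
    = (v i - v j) * ((if i == r then rho j else 1) * (if j == r then rho i else 1)).
  move=> ij; have nij : i != j by rewrite neq_ltn ij.
  case: (i =P r) nij => [->|/eqP ir] nij.
    by rewrite eq_sym (negPf nij) mulr1 mulrC divfK ?vB // (uv j) // eq_sym.
  case: (j =P r) => [->|/eqP jr]; last by rewrite !mulr1 !uv.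
  rewrite mul1r -(opprB (v r)) mulNr mulrC divfK ?vB 1?eq_sym //.
  by rewrite opprB uv.
under eq_bigr => i _ do under eq_bigr => j ij do rewrite E //.
under eq_bigr => i _ do rewrite !big_split /=.
rewrite [LHS]big_split; congr (_ * _); rewrite [LHS]big_split /=.
rewrite [RHS](bigID (fun j : 'I_N => (r < j)%N)) /=; congr (_ * _).
  rewrite (bigD1 r) //= [X in _ * X]big1 ?mulr1 => [|i ir]; last first.
    by rewrite (negPf ir) big1.
  by rewrite eqxx; apply: eq_bigl => j; rewrite neq_ltn; case: ltngtP.
transitivity (\prod_(i < N) if (i < r)%N then rho i else 1).
  apply: eq_bigr => i _; case: ifP => ir.
    rewrite (bigD1 r) //= eqxx big1 ?mulr1 // => j /andP[_ jr].
    by rewrite (negPf jr).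
  by rewrite big1 // => j ij; case: eqP => // jr; rewrite -jr ij in ir.
rewrite -big_mkcond /=; apply: eq_bigl => j.
by rewrite neq_ltn; case: ltngtP.
Qed.

(** The content of the first cell to the right of row i, that is, of the cell
    that increasing row i adds. *)
Definition row_content (la : seq nat) (i : nat) : rat := (nth 0%N la i)%:R - i%:R.

Definition beta N (la : seq nat) (i : nat) : nat := (nth 0 la i + (N - i.+1))%N.

(** Frobenius' expression for f_la / n!, in which la is completed by empty rows
    to N rows in total. *)
Definition dim_ratio N (la : seq nat) : rat :=
  (\prod_(i < N) \prod_(j < N | (i < j)%N) (row_content la i - row_content la j))
  / \prod_(i < N) (beta N la i)`!%:R.

Lemma row_content_incr la i j :
  row_content (incr_nth la i) j = row_content la j + (j == i)%:R.
Proof. by rewrite /row_content nth_incr_nth natrD eq_sym; ring. Qed.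

Lemma row_content_default la i : (size la <= i)%N -> row_content la i = - i%:R.
Proof. by move=> le; rewrite /row_content nth_default // sub0r. Qed.

Lemma row_content_lt n la i j : is_partition n la -> (i < j)%N ->
  row_content la j < row_content la i.
Proof.
move=> Pla ij; rewrite /row_content ltrBlDr addrAC ltrBrDr -!natrD ltr_nat.
by have := partition_nth_le Pla (ltnW ij); lia.
Qed.

Lemma row_content_inj n la i j : is_partition n la ->
  row_content la i = row_content la j -> i = j.
Proof.
by move=> Pla E; case: (ltngtP i j) => // /(row_content_lt Pla); rewrite E ltxx.
Qed.

Lemma betaE N la i : (i < N)%N -> (beta N la i)%:R = row_content la i + N%:R - 1 :> rat.
Proof.
by move=> iN; rewrite /beta /row_content natrD natrB // -natr1; ring.
Qed.

Lemma prod_beta_incr N la (r : 'I_N) :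
  \prod_(i < N) (beta N (incr_nth la r) i)`!%:R
    = (beta N la r).+1%:R * \prod_(i < N) (beta N la i)`!%:R :> rat.
Proof.
rewrite (bigD1 r) //= [in RHS](bigD1 r) //= mulrA /beta nth_incr_nth eqxx.
rewrite addSn factS natrM; congr (_ * _); apply: eq_bigr => i ir.
by rewrite nth_incr_nth -val_eqE /= eq_sym in ir *; rewrite (negPf ir).
Qed.

Lemma dim_ratio_nil N : dim_ratio N [::] = 1.
Proof.
apply: (canLR (mulfK _)); last first.
  rewrite mul1r; apply: eq_bigr => i _.
  rewrite /beta nth_nil add0n fact_prod natr_prod.
  rewrite -(big_geq_mkord _ _ predT (fun j : nat => row_content _ i - row_content _ j)).
  rewrite [RHS]big_add1 [LHS](big_addn 0 N i.+1); apply: eq_bigr => k _.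
  by rewrite /row_content !nth_nil !mulr0n !sub0r opprK addrC -natrB ?leq_addl; [congr _%:R|]; lia.
by apply/prodf_neq0 => i _; rewrite pnatr_eq0 -lt0n fact_gt0.
Qed.

(** The contents of the cells after and at the end of each row.  When la has at
    most N rows, common values cancel in the rational function with poles the
    former and zeros the latter, leaving the contents of the addable cells as
    poles and those of the corners as zeros. *)
Definition next_contents N la (i : 'I_N.+1) := row_content la i.
Definition last_contents N la (j : 'I_N) := row_content la j - 1.

Definition up_weight N (la : seq nat) : 'I_N.+1 -> rat :=
  weight (@next_contents N la) (@last_contents N la).

(** Row N is empty, so its content is - N and the corresponding factor of the
    Vandermonde ratio is the one that the factorial cancels; this is why the
    weight has one zero less than it has poles. *)
Lemma dim_ratio_incr n N la (r : 'I_N.+1) :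
  is_partition n la -> (size la <= N)%N ->
  dim_ratio N.+1 (incr_nth la r) = dim_ratio N.+1 la * up_weight la r.
Proof.
move=> Pla szla.
rewrite /dim_ratio prod_beta_incr.
rewrite (@vandermonde_update _ _ (fun i => row_content la i) r); first last.
- move=> i ir; rewrite row_content_incr -val_eqE /= in ir *.
  by rewrite (negPf ir) addr0.
- by move=> i j /(row_content_inj Pla)/val_inj.
rewrite row_content_incr eqxx invfM (mulrC _.+1%:R^-1) mulrACA; congr (_ * _).
rewrite /up_weight /weight /last_contents /next_contents prodf_div mulrAC; congr (_ / _).
have bE := betaE la (ltn_ord r).
apply: (canLR (mulfK _)); first by rewrite pnatr_eq0.
transitivity (\prod_(j < N.+1) (row_content la r + 1 - row_content la j)).
  rewrite [RHS](bigD1 r) //= (_ : _ + 1 - _ = 1) ?mul1r //; ring.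
rewrite big_ord_recr /= (row_content_default szla); congr (_ * _).
  by apply: eq_bigr => j _; ring.
by rewrite -natr1 bE -natr1; ring.
Qed.

Definition down_coef N (la : seq nat) (r : 'I_N) : rat :=
  (beta N la r)%:R * \prod_(j < N | j != r)
    ((row_content la r - 1 - row_content la j) / (row_content la r - row_content la j)).

Lemma dim_ratio_decr n N la (r : 'I_N) :
  is_partition n la -> removable la r ->
  dim_ratio N (decr_nth la r) = dim_ratio N la * down_coef la r.
Proof.
move=> Pla la_r; have Dla j : row_content (decr_nth la r) j
    = row_content la j - (j == r)%:R.
  by rewrite -[in RHS](decr_nthK Pla la_r) row_content_incr addrK.
rewrite /dim_ratio (@vandermonde_update _ _ (fun i => row_content la i) r); first last.
- by move=> i ir; rewrite Dla -val_eqE /= in ir *; rewrite (negPf ir) subr0.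
- by move=> i j /(row_content_inj Pla)/val_inj.
rewrite Dla eqxx -[in X in _ = _ / X * _](decr_nthK Pla la_r) prod_beta_incr.
have -> : (beta N (decr_nth la r) r).+1 = beta N la r.
  by rewrite /beta (nth_decr_nth Pla la_r) eqxx; move: la_r; rewrite /removable; lia.
have b0 : (beta N la r)%:R != 0 :> rat.
  by rewrite pnatr_eq0 -lt0n /beta; move: la_r; rewrite /removable; lia.
rewrite /down_coef mulr1n invfM; move: (\prod_(j < N | j != r) _) => P.
have {1}-> : P = (beta N la r)%:R^-1 * (beta N la r)%:R * P by rewrite mulVf // mul1r.
ring.
Qed.

Lemma down_coef_eq0 n N la (r : 'I_N) :
  is_partition n la -> (size la <= N)%N -> ~~ removable la r -> down_coef la r = 0.
Proof.
move=> Pla szla; rewrite /removable -leqNgt => le.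
have E : nth 0%N la r.+1 = nth 0%N la r.
  by apply/eqP; rewrite eqn_leq le (partition_nth_le Pla).
case: (ltnP r.+1 N) => rN.
  rewrite /down_coef (bigD1 (Ordinal rN)) /=; last by rewrite -val_eqE /= gtn_eqF.
  rewrite [X in X / _ * _](_ : _ = 0) ?mul0r ?mulr0 //.
  by rewrite /row_content E -(natr1 r); ring.
rewrite /down_coef (_ : beta N la r = 0%N) ?mul0r //.
by rewrite /beta -E nth_default //; lia.
Qed.

Lemma sum_rows N la : (size la <= N)%N -> (\sum_(i < N) nth 0 la i = sumn la)%N.
Proof.
move=> szla; rewrite sumnE (big_nth 0) -(big_mkord xpredT (nth 0 la)).
rewrite (big_cat_nat (leq0n _) szla) /= [X in (_ + X)%N]big_nat_cond.
rewrite [X in (_ + X)%N]big1 ?addn0 // => i /andP[/andP[le _] _].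
by rewrite nth_default.
Qed.

(** Viewed with one more empty row, the coefficient of row r is, up to sign, the
    residue at a_r of prod_j (z - (a_j + 1)) / prod_i (z - a_i) times
    (z + N) (z + N - 1).  The factor z + N cancels the pole of the extra row,
    so the sum is a combination of the moments of order at most 2, which
    Newton's identities compute. *)
Lemma sum_down_coef n N la :
  is_partition n la -> (size la <= N)%N -> \sum_(r < N) down_coef la r = n%:R.
Proof.
move=> Pla szla.
pose x (i : 'I_N.+1) := row_content la i.
pose y (j : 'I_N) := row_content la j + 1.
have x_inj : injective x by move=> i j /(row_content_inj Pla)/val_inj.
have sum_a : 2 * \sum_(i < N) row_content la i = 2 * n%:R - N%:R * (N%:R - 1).
  rewrite sumrB -!natr_sum sum_rows //; have [_ _ ->] := is_partitionP _ _ Pla.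
  rewrite mulrBr; congr (_ - _).
  by elim: (N) => [|M IH]; rewrite ?big_ord0 ?big_ord_recr ?natrD /= ?mulrDr ?IH -?natr1; ring.
transitivity (- (moment x y 2 + (2 * N%:R - 1) * moment x y 1
                 + N%:R * (N%:R - 1) * moment x y 0)).
  rewrite /moment !mulr_sumr -!big_split /= -sumrN [RHS]big_ord_recr /=.
  rewrite [x ord_max](row_content_default szla) [X in _ + X](_ : _ = 0) ?addr0; last by ring.
  apply: eq_bigr => r _.
  have bE := betaE la (ltn_ord r).
  have aN0 : row_content la r + N%:R != 0.
    have -> : row_content la r + N%:R = (beta N la r).+1%:R by rewrite -natr1 bE; ring.
    by rewrite pnatr_eq0.
  have wE : weight x y (widen_ord (leqnSn N) r) * (row_content la r + N%:R)
      = - \prod_(j < N | j != r)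
        ((row_content la r - 1 - row_content la j) / (row_content la r - row_content la j)).
    rewrite /weight prodf_div (bigD1 r) //= {1}/x /y.
    rewrite [X in _ / X * _]big_mkcond big_ord_recr /=.
    rewrite [X in _ / (_ * X) * _](_ : _ = row_content la r + N%:R); last first.
      by rewrite -val_eqE /= gtn_eqF // /x (row_content_default szla) opprK.
    rewrite -[X in _ / (X * _) * _]big_mkcond /= invfM mulrA divfK //.
    rewrite -mulNr; congr (_ / _).
    rewrite (_ : _ - _ = -1) ?mulN1r; last by rewrite /=; ring.
    by congr (- _); apply: eq_bigr => j _; rewrite /x /=; ring.
  rewrite /down_coef bE.
  set P := \prod_(j < N | _) _ in wE *.
  have -> : P = - (weight x y (widen_ord (leqnSn N) r) * (row_content la r + N%:R)).
    by rewrite wE opprK.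
  by rewrite /x /=; ring.
have N0 := moment0 y x_inj.
have N1 := newton_moments y x_inj 1; have N2 := newton_moments y x_inj 2.
move: N1 N2; rewrite !big_ord_recr !big_ord0 /= N0 !add0r mulr1 mul1r => N1 N2.
have qE k : psum_diff x y k = (- N%:R) ^+ k
    + \sum_(i < N) (row_content la i ^+ k - (row_content la i + 1) ^+ k).
  by rewrite sumrB -(row_content_default szla) /psum_diff big_ord_recr addrAC addrC.
have q1 : psum_diff x y 1 = - 2 * N%:R.
  rewrite qE (eq_bigr (fun=> - 1)) => [|i _]; last by ring.
  by rewrite sumr_const card_ord; ring.
have q2 : psum_diff x y 2 = N%:R ^+ 2 - N%:R - 2 * \sum_(i < N) row_content la i.
  rewrite qE (eq_bigr (fun i : 'I_N => - (2 * row_content la i) - 1)) => [|i _]; last by ring.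
  by rewrite sumrB sumrN -mulr_sumr sumr_const card_ord; ring.
have {N2} : 2 * moment x y 2 = 4 * N%:R ^+ 2 + N%:R ^+ 2 - N%:R - (2 * n%:R - N%:R * (N%:R - 1)).
  by rewrite N2 N1 q1 q2 sum_a; ring.
by rewrite N1 q1 => N2; lra.
Qed.

(** Both sides satisfy the branching rule, by the preceding summation. *)
Lemma num_SYT_dim_ratio n N la :
  is_partition n la -> (size la <= N)%N ->
  (num_SYT la)%:R = n`!%:R * dim_ratio N la.
Proof.
elim: n la => [|n IH] la Pla szla.
  have -> : la = [::] by apply/nilP; have := size_partition Pla; rewrite leqn0.
  rewrite dim_ratio_nil mulr1 num_SYT_lin_exts.
  rewrite (_ : lin_exts _ _ = [set: _]%SET) ?cardsT ?card_ffun ?card_seq_sub //.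
  by apply/finset.setP => T; rewrite !inE; apply/andP; split; [apply/injectiveP|apply/forallP]; case.
rewrite (num_SYT_branching Pla szla) natr_sum.
transitivity (\sum_(r < N | removable la r) n`!%:R * (dim_ratio N la * down_coef la r)).
  apply: eq_bigr => r la_r; rewrite (IH _ (is_partition_decr Pla la_r)).
    by rewrite (dim_ratio_decr Pla la_r).
  exact: leq_trans (size_decr_nth Pla la_r) szla.
rewrite -mulr_sumr -mulr_sumr factS natrM -(sum_down_coef Pla szla).
rewrite [X in _ = X * _ * _](bigID (fun r : 'I_N => removable la r)) /=.
rewrite [X in _ = (_ + X) * _ * _]big1 ?addr0 => [|r]; first by ring.
exact: down_coef_eq0 Pla szla.
Qed.

(** * Shifted symmetric functions and Plancherel averages *)

(** Subtracting the value at the empty row makes the sum independent of the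
    number of empty rows appended. *)
Definition row_psum k (la : seq nat) : rat :=
  \sum_(i < size la) (row_content la i ^+ k - (- i%:R) ^+ k).

Lemma row_psum_widen N k la : (size la <= N)%N ->
  row_psum k la = \sum_(i < N) (row_content la i ^+ k - (- i%:R) ^+ k).
Proof.
move=> szla; rewrite -(big_mkord xpredT (fun i => row_content la i ^+ k - (- i%:R) ^+ k)).
rewrite (big_cat_nat (leq0n _) szla) /= [X in _ + X]big_nat_cond.
rewrite [X in _ + X]big1 ?addr0 ?big_mkord // => i /andP[/andP[le _] _].
by rewrite row_content_default // subrr.
Qed.

(** The functions represented by polynomials of weight at most d in the
    [row_psum k], where [row_psum k] has weight k + 1. *)
Inductive wpoly : nat -> (seq nat -> rat) -> Prop :=
| wpoly_const d c : wpoly d (fun=> c)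
| wpoly_psum d k : (k < d)%N -> wpoly d (row_psum k)
| wpoly_add d g h : wpoly d g -> wpoly d h -> wpoly d (fun la => g la + h la)
| wpoly_mul d e g h : wpoly d g -> wpoly e h -> wpoly (d + e) (fun la => g la * h la)
| wpoly_ext d g h : wpoly d g -> g =1 h -> wpoly d h.

Lemma wpoly_le d e g : (d <= e)%N -> wpoly d g -> wpoly e g.
Proof.
move=> + gd; elim: gd e => {d g}.
- by move=> d c e _; apply: wpoly_const.
- by move=> d k kd e de; apply/wpoly_psum/(leq_trans kd).
- by move=> d g h _ IHg _ IHh e de; apply: wpoly_add; [apply: IHg|apply: IHh].
- move=> d1 d2 g h _ IHg hd _ e de.
  rewrite -(subnK (leq_trans (leq_addl _ _) de)).
  by apply: wpoly_mul => //; apply: IHg; rewrite leq_subRL ?(leq_trans (leq_addl _ _) de) // addnC.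
- by move=> d g h _ IHg gh e de; apply: wpoly_ext (IHg _ de) gh.
Qed.

Lemma wpoly_scale d c g : wpoly d g -> wpoly d (fun la => c * g la).
Proof. by move=> gd; rewrite -[d]add0n; apply: wpoly_mul => //; apply: wpoly_const. Qed.

Lemma wpoly_sum (I : Type) (r : seq I) (P : pred I) d (g : I -> seq nat -> rat) :
  (forall i, P i -> wpoly d (g i)) -> wpoly d (fun la => \sum_(i <- r | P i) g i la).
Proof.
move=> gd; elim: r => [|i r IH].
  by apply: wpoly_ext (wpoly_const d 0) _ => la; rewrite big_nil.
case Pi: (P i); last by apply: wpoly_ext IH _ => la; rewrite big_cons Pi.
by apply: wpoly_ext (wpoly_add (gd _ Pi) IH) _ => la; rewrite big_cons Pi.
Qed.

(** Polynomials in c and the [row_psum k], where c has weight 1 and the total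
    weight is at most d - 2.  The offset is that of the difference operator:
    with it, the differences of functions of weight d satisfy [dpoly d], and
    for d < 2 only 0 remains. *)
Inductive dpoly : nat -> (seq nat -> rat -> rat) -> Prop :=
| dpoly0 d : dpoly d (fun _ _ => 0)
| dpoly_mono d e k g : wpoly e g -> (k + e + 2 <= d)%N ->
    dpoly d (fun la c => c ^+ k * g la)
| dpoly_add d G H : dpoly d G -> dpoly d H -> dpoly d (fun la c => G la c + H la c)
| dpoly_ext d G H : dpoly d G -> (forall la c, G la c = H la c) -> dpoly d H.

Lemma dpoly_scale d e h G : wpoly e h -> dpoly d G ->
  dpoly (e + d) (fun la c => h la * G la c).
Proof.
move=> he; elim=> {d G}.
- by move=> d; apply: dpoly_ext (dpoly0 _) _ => la c; rewrite mulr0.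
- move=> d e' k g ge' le; apply: (@dpoly_ext _ (fun la c => c ^+ k * (h la * g la))).
    by apply: dpoly_mono; [apply: wpoly_mul he ge'|lia].
  by move=> la c; rewrite mulrCA.
- move=> d G H _ IHG _ IHH; apply: dpoly_ext (dpoly_add IHG IHH) _ => la c.
  by rewrite mulrDr.
- by move=> d G H _ IHG GH; apply: dpoly_ext IHG _ => la c; rewrite GH.
Qed.

Lemma dpoly_mul d e G H : dpoly d G -> dpoly e H ->
  dpoly (d + e) (fun la c => G la c * H la c).
Proof.
move=> Gd He; elim: Gd => {d G}.
- by move=> d; apply: dpoly_ext (dpoly0 _) _ => la c; rewrite mul0r.
- move=> d e' k g ge' le; elim: He => {e H}.
  + by move=> e; apply: dpoly_ext (dpoly0 _) _ => la c; rewrite mulr0.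
  + move=> e e'' l h he'' le'.
    apply: (@dpoly_ext _ (fun la c => c ^+ (k + l) * (g la * h la))).
      by apply: dpoly_mono; [apply: wpoly_mul ge' he''|lia].
    by move=> la c; rewrite exprD mulrACA.
  + move=> e G H _ IHG _ IHH; apply: dpoly_ext (dpoly_add IHG IHH) _ => la c.
    by rewrite mulrDr.
  + by move=> e G H _ IHG GH; apply: dpoly_ext IHG _ => la c; rewrite GH.
- move=> d G K _ IHG _ IHK; apply: dpoly_ext (dpoly_add IHG IHK) _ => la c.
  by rewrite mulrDl.
- by move=> d G K _ IHG GK; apply: dpoly_ext IHG _ => la c; rewrite GK.
Qed.

Lemma dpoly_sum (I : Type) (r : seq I) (P : pred I) d (G : I -> seq nat -> rat -> rat) :
  (forall i, P i -> dpoly d (G i)) ->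
  dpoly d (fun la c => \sum_(i <- r | P i) G i la c).
Proof.
move=> Gd; elim: r => [|i r IH].
  by apply: dpoly_ext (dpoly0 d) _ => la c; rewrite big_nil.
case Pi: (P i); last by apply: dpoly_ext IH _ => la c; rewrite big_cons Pi.
by apply: dpoly_ext (dpoly_add (Gd _ Pi) IH) _ => la c; rewrite big_cons Pi.
Qed.

Lemma row_psum_incr k la i :
  row_psum k (incr_nth la i)
    = row_psum k la + ((row_content la i + 1) ^+ k - row_content la i ^+ k).
Proof.
pose N := maxn (size la) i.+1.
have iN : (i < N)%N by rewrite leq_max ltnSn orbT.
rewrite !(@row_psum_widen N) ?leq_maxl //; last first.
  by rewrite size_incr_nth; case: ifP => _; rewrite leq_max leqnn ?orbT.
rewrite (bigD1 (Ordinal iN)) //= [in RHS](bigD1 (Ordinal iN)) //=.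
rewrite row_content_incr eqxx mulr1n.
rewrite (eq_bigr (fun j : 'I_N => row_content la j ^+ k - (- j%:R) ^+ k)); first by ring.
move=> j ji; rewrite row_content_incr -val_eqE /= in ji *.
by rewrite (negPf ji) addr0.
Qed.

(** The discrete Leibniz rule reduces this to the generators; there
    (c + 1)^k - c^k has degree k - 1 while [row_psum k] has weight k + 1. *)
Lemma wpoly_difference d g : wpoly d g ->
  exists2 G, dpoly d G &
    forall la i, g (incr_nth la i) = g la + G la (row_content la i).
Proof.
elim=> {d g}.
- by move=> d c; exists (fun _ _ => 0); [apply: dpoly0|move=> *; rewrite addr0].
- move=> d k kd; exists (fun la c => \sum_(l < k) c ^+ l * 'C(k, l)%:R).
    by apply: dpoly_sum => l _; apply: dpoly_mono (wpoly_const 0 _) _; have := ltn_ord l; lia.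
  move=> la i; rewrite row_psum_incr exprD1_sub; congr (_ + _).
  by apply: eq_bigr => l _; rewrite mulrC.
- move=> d g h _ [G Gd gG] _ [H Hd hH].
  exists (fun la c => G la c + H la c); first exact: dpoly_add.
  by move=> la i; rewrite gG hH addrACA.
- move=> d e g h gd [G Gd gG] he [H He hH].
  exists (fun la c => g la * H la c + h la * G la c + G la c * H la c).
    apply: dpoly_add; last exact: dpoly_mul.
    apply: dpoly_add; first exact: dpoly_scale.
    by rewrite addnC; apply: dpoly_scale.
  by move=> la i; rewrite gG hH; ring.
- move=> d g h _ [G Gd gG] gh; exists G => // la i.
  by rewrite -!gh.
Qed.

(** The coefficient of c^l in c^k - (c - 1)^k. *)
Definition backward_coef k l : rat := - (-1) ^+ (k + l) * 'C(k, l)%:R.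

Lemma exprB1_sub (c : rat) k :
  c ^+ k - (c - 1) ^+ k = \sum_(l < k) backward_coef k l * c ^+ l.
Proof.
have -> : c ^+ k - (c - 1) ^+ k = - (-1) ^+ k * ((- c + 1) ^+ k - (- c) ^+ k).
  rewrite -{1 2}(opprK c); move: (- c) => b; rewrite -opprD.
  by rewrite !(exprNn b) (exprNn (b + 1)); ring.
rewrite exprD1_sub mulr_sumr; apply: eq_bigr => l _.
by rewrite (exprNn c) /backward_coef exprD; ring.
Qed.

(** For empty rows the sum telescopes to 0^k, whatever N is; the rest is a sum
    of differences c^k - (c - 1)^k, of degree k - 1. *)
Lemma psum_diff_up N la k : (size la <= N)%N ->
  psum_diff (@next_contents N la) (@last_contents N la) k
    = 0 ^+ k + \sum_(l < k) backward_coef k l * row_psum l la.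
Proof.
move=> szla.
have -> : psum_diff (@next_contents N la) (@last_contents N la) k = (- N%:R) ^+ k
    + \sum_(i < N) (row_content la i ^+ k - (row_content la i - 1) ^+ k).
  rewrite sumrB -(row_content_default szla) /psum_diff big_ord_recr.
  by rewrite addrAC addrC.
have -> : 0 ^+ k = (- N%:R) ^+ k
    + \sum_(i < N) ((- i%:R) ^+ k - (- i%:R - 1) ^+ k) :> rat.
  elim: (N) => [|M IH]; first by rewrite big_ord0 addr0 oppr0.
  rewrite big_ord_recr /= IH -natr1 opprD; ring.
rewrite -addrA; congr (_ + _).
under eq_bigr => i _ do rewrite exprB1_sub.
under [X in _ = X + _]eq_bigr => i _ do rewrite exprB1_sub.
rewrite exchange_big [X in _ = X + _]exchange_big -big_split /=.
apply: eq_bigr => l _; rewrite (row_psum_widen _ szla) -!mulr_sumr -mulrDr; congr (_ * _).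
by rewrite -big_split; apply: eq_bigr => i _ /=; rewrite addrC subrK.
Qed.

(** Newton's identities express the moments recursively by power sums, and by
    [psum_diff_up] the j-th of these has weight j. *)
Lemma wpoly_up_moment k : exists2 h, wpoly k h &
  forall n N la, is_partition n la -> (size la <= N)%N ->
    \sum_(r < N.+1) up_weight la r * row_content la r ^+ k = h la.
Proof.
elim/ltn_ind: k => k IH.
suff [h hk hE] : exists2 h, wpoly k h &
    forall n N la, is_partition n la -> (size la <= N)%N ->
      moment (@next_contents N la) (@last_contents N la) k = h la by exists h.
have next_inj n N la : is_partition n la -> injective (@next_contents N la).
  by move=> Pla i j /(row_content_inj Pla)/val_inj.
have [k0|k_gt0] := posnP k.
  rewrite k0; exists (fun=> 1) => [|n N la Pla _]; first exact: wpoly_const.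
  exact: moment0 (next_inj _ _ _ Pla).
suff [h hk hE] : exists2 h, wpoly k h &
    forall n N la, is_partition n la -> (size la <= N)%N ->
      k%:R * moment (@next_contents N la) (@last_contents N la) k = h la.
  exists (fun la => k%:R^-1 * h la); first exact: wpoly_scale.
  by move=> n N la Pla szla; rewrite -(hE _ _ _ Pla szla) mulKf // pnatr_eq0 -lt0n.
pose q j la : rat := 0 ^+ j + \sum_(l < j) backward_coef j l * row_psum l la.
have qj j : wpoly j (q j).
  apply: wpoly_add; first exact: wpoly_const.
  by apply: wpoly_sum => l _; apply/wpoly_scale/wpoly_psum/ltn_ord.
have /fin_all_exists2[m mk mE] : forall j : 'I_k, exists2 h, wpoly (k - j.+1) h &
    forall n N la, is_partition n la -> (size la <= N)%N ->
      moment (@next_contents N la) (@last_contents N la) (k - j.+1) = h la.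
  by move=> j; apply: IH; rewrite ltn_subrL.
exists (fun la => \sum_(j < k) q j.+1 la * m j la).
  apply: wpoly_sum => j _; apply: wpoly_le (wpoly_mul (qj j.+1) (mk j)).
  by rewrite subnKC.
move=> n N la Pla szla; rewrite (newton_moments _ (next_inj _ _ _ Pla)).
by apply: eq_bigr => j _; rewrite (mE j _ _ _ Pla szla) psum_diff_up.
Qed.

(** Averaging replaces each c^k by the k-th moment, which has the same weight.
    The truncated d - 2 is harmless because there are no monomials for d < 2. *)
Lemma dpoly_up_average d G : dpoly d G ->
  exists h, [/\ wpoly (d - 2) h, (d < 2)%N -> forall la, h la = 0 &
    forall n N la, is_partition n la -> (size la <= N)%N ->
      \sum_(r < N.+1) up_weight la r * G la (row_content la r) = h la].
Proof.
elim=> {d G}.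
- move=> d; exists (fun=> 0); split=> // [|n N la _ _]; first exact: wpoly_const.
  by rewrite big1 // => r _; rewrite mulr0.
- move=> d e k g ge le; have [m mk mE] := wpoly_up_moment k.
  exists (fun la => m la * g la); split; last 1 first.
  + move=> n N la Pla szla; rewrite -(mE _ _ _ Pla szla) mulr_suml.
    by apply: eq_bigr => r _; rewrite mulrA.
  + by apply: wpoly_le (wpoly_mul mk ge); lia.
  + lia.
- move=> d G H _ [g [gd g0 gE]] _ [h [hd h0 hE]].
  exists (fun la => g la + h la); split=> [|d2 la|n N la Pla szla].
  + exact: wpoly_add.
  + by rewrite g0 // h0 // addr0.
  + rewrite -(gE _ _ _ Pla szla) -(hE _ _ _ Pla szla) -big_split /=.
    by apply: eq_bigr => r _; rewrite mulrDr.
- move=> d G H _ [h [hd h0 hE]] GH; exists h; split=> // n N la Pla szla.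
  by rewrite -(hE _ _ _ Pla szla); apply: eq_bigr => r _; rewrite GH.
Qed.

Lemma is_partition_incr n la i : is_partition n la ->
  (i == 0) || (nth 0 la i < nth 0 la i.-1)%N -> is_partition n.+1 (incr_nth la i).
Proof.
move=> Pla addable; apply/is_partitionP; split=> [j|j|].
- rewrite !nth_incr_nth; have := partition_nth_le Pla (leqnSn j).
  by case: (i =P j.+1) addable => [->|_] /=; lia.
- rewrite nth_incr_nth size_incr_nth -(partition_nth_gt0 _ Pla) => lt.
  case: (i =P j) => //= /eqP ij; rewrite add0n (partition_nth_gt0 _ Pla).
  move: lt; case: ifP => _ //; rewrite ltnS leq_eqVlt eq_sym (negPf ij) /= => ji.
  case/orP: addable => [/eqP i0|lt]; first by rewrite i0 in ji.
  rewrite -(partition_nth_gt0 _ Pla) (leq_trans _ (partition_nth_le Pla (_ : j <= i.-1)%N)) //.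
    by apply: leq_trans lt.
  by case: (i) ji.
by rewrite sumn_incr_nth; case/is_partitionP: Pla => _ _ ->.
Qed.

(** If row r cannot be increased, it is as long as row r - 1, and then the last
    content of row r - 1 is a zero that cancels the pole of row r. *)
Lemma up_weight_eq0 n N la (r : 'I_N.+1) : is_partition n la ->
  ~~ is_partition n.+1 (incr_nth la r) -> up_weight la r = 0.
Proof.
move=> Pla /(contra (is_partition_incr Pla)); rewrite negb_or -leqNgt => /andP[r0 le].
have r1N : (r.-1 < N)%N by have := ltn_ord r; lia.
rewrite /up_weight /weight /last_contents /next_contents (bigD1 (Ordinal r1N)) //=.
have -> : row_content la r.-1 = row_content la r + 1.
  rewrite /row_content; have -> : nth 0%N la r.-1 = nth 0%N la r.
    by apply/eqP; rewrite eqn_leq le (partition_nth_le Pla) // leq_pred.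
  have -> : r = r.-1.+1 :> nat by rewrite prednK // lt0n.
  by rewrite -natr1; ring.
by rewrite (_ : _ - _ = 0) ?mul0r //; ring.
Qed.

Lemma sum_up_weight n N la : is_partition n la ->
  \sum_(r < N.+1) up_weight la r = 1.
Proof.
move=> Pla; rewrite -[RHS](moment0 (@last_contents N la) (_ : injective (@next_contents N la))).
  by apply: eq_bigr => r _; rewrite mulr1.
by move=> i j /(row_content_inj Pla)/val_inj.
Qed.

Definition plancherel n (g : seq nat -> rat) : rat :=
  n`!%:R^-1 * \sum_(la <- partitions n) (num_SYT la)%:R ^+ 2 * g la.

(** f_(mu + cell) / ((n + 1) f_mu) is the up-weight of the added cell, and these
    weights have sum 1. *)
Lemma plancherel_step g G n h :
  (forall la i, g (incr_nth la i) = g la + G la (row_content la i)) ->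
  (forall n N la, is_partition n la -> (size la <= N)%N ->
      \sum_(r < N.+1) up_weight la r * G la (row_content la r) = h la) ->
  plancherel n.+1 g = plancherel n g + plancherel n h.
Proof.
move=> gG hE; rewrite /plancherel.
have ff m la N : la \in partitions m -> (m <= N)%N ->
  (num_SYT la)%:R = m`!%:R * dim_ratio N la.
  rewrite mem_partitions => Pla mN.
  by apply: num_SYT_dim_ratio => //; apply: leq_trans mN; apply: size_partition.
have fact0 m : m`!%:R != 0 :> rat by rewrite pnatr_eq0 -lt0n fact_gt0.
pose H la := (n.+1)`!%:R^-1 * (num_SYT la)%:R * g la.
transitivity (\sum_(la <- partitions n.+1) (num_SYT la)%:R * H la).
  by rewrite mulr_sumr; apply: eq_bigr => la _; rewrite /H; ring.
(* Shapes of size n have at most n rows, and one further, empty row is needed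
   for the weights; n + 2 rows are enough for the sizes n and n + 1 alike. *)
rewrite (@sum_SYT_exchange _ n.+2) // -mulrDr -big_split mulr_sumr /=.
rewrite [LHS]big_seq [RHS]big_seq; apply: eq_bigr => mu mu_in.
have Pmu : is_partition n mu by rewrite -mem_partitions.
have szmu : (size mu <= n.+1)%N by rewrite (leq_trans (size_partition Pmu)).
have fmu := ff _ _ n.+2 mu_in (leq_trans (leqnSn _) (leqnSn _)).
transitivity ((num_SYT mu)%:R * \sum_(i < n.+2)
    dim_ratio n.+2 mu * (up_weight mu i * (g mu + G mu (row_content mu i)))).
  congr (_ * _); rewrite big_mkcond; apply: eq_bigr => i _.
  case: ifPn => [Pi|nPi]; last by rewrite (up_weight_eq0 Pmu nPi) mul0r mulr0.
  rewrite /H (ff n.+1 _ n.+2) ?mem_partitions // mulKf // gG.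
  by rewrite (dim_ratio_incr _ Pmu) // mulrA.
rewrite -mulr_sumr.
under eq_bigr => i _ do rewrite mulrDr.
rewrite big_split /= (hE _ _ _ Pmu szmu) -mulr_suml.
rewrite (sum_up_weight _ Pmu) mul1r fmu.
set c : rat := n`!%:R; set f := dim_ratio _ _.
transitivity (c^-1 * c * (c * f * f * (g mu + h mu))); last by ring.
by rewrite mulVf ?fact0 //; ring.
Qed.

(** Consecutive averages of g differ by averages of a function whose weight is
    smaller by two, which are polynomial in n by induction. *)
Lemma plancherel_polynomial d g : wpoly d g ->
  exists P : {poly rat}, forall n, plancherel n g = P.[n%:R].
Proof.
elim/ltn_ind: d g => d IH g gd.
have [G Gd gG] := wpoly_difference gd.
have [h [hd h0 hE]] := dpoly_up_average Gd.
have [Q QE] : exists Q : {poly rat}, forall n, plancherel n h = Q.[n%:R].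
  have [d2|d2] := ltnP d 2; last by apply: (IH (d - 2)%N) => //; lia.
  exists 0 => n; rewrite horner0 /plancherel big1 ?mulr0 // => la _.
  by rewrite h0 // mulr0.
have [S SE] := antidifference Q.
exists (S + (plancherel 0 g - S.[0])%:P) => n; rewrite hornerD hornerC.
elim: n => [|n IHn]; first by rewrite addrC subrK.
by rewrite (plancherel_step n gG hE) IHn QE -SE -natr1; ring.
Qed.

(** * Power sums of hook lengths *)

(** Induction on the rows below a first row of length x: appending a last row of
    length y to la increases the first y hooks by one.  These were the
    consecutive numbers x - y + size la + 1, ..., x + size la, so the least of
    them is traded for x + size la + 1; and it comes back as the number
    x - y + size la + 1 that the new row contributes to the second sum. *)
Lemma first_row_hooks (f : nat -> rat) x la : pairwise geq (x :: la) ->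
  \sum_(j < x) f (x - j + conj_part la j)%N
    + \sum_(i < size la) f (x - nth 0 la i + i.+1)%N
  = \sum_(s < x + size la) f s.+1.
Proof.
elim/last_ind: la => [_|la y IH].
  rewrite big_ord0 addr0 addn0 (reindex_inj rev_ord_inj) /=.
  by apply: eq_bigr => j _; congr f; rewrite /conj_part /=; have := ltn_ord j; lia.
rewrite /= all_rcons pairwise_rcons => /andP[/andP[yx la_x] /andP[la_y la_dec]].
have {IH} := IH; rewrite /= la_x la_dec => /(_ isT) IH.
rewrite size_rcons addnS !big_ord_recr /= -IH nth_rcons ltnn eqxx.
under [X in _ + (X + _)]eq_bigr => i _ do rewrite nth_rcons ltn_ord.
suff -> : \sum_(j < x) f (x - j + conj_part (rcons la y) j)%N
    = \sum_(j < x) f (x - j + conj_part la j)%N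
      + (f (x + size la).+1 - f (x - y + (size la).+1)%N) by ring.
rewrite /= in yx *.
have -> : f (x + size la).+1 - f (x - y + (size la).+1)%N
    = \sum_(j < y) (f (x - j + (size la).+1)%N - f (x - j + size la)%N).
  rewrite -(big_mkord xpredT (fun j => f (x - j + (size la).+1)%N - f (x - j + size la)%N)).
  have := telescope_sumr (fun j => - f (x - j + (size la).+1)%N) (leq0n y).
  rewrite subn0 opprK addrC addnS => <-.
  rewrite !big_mkord; apply: eq_bigr => j _; rewrite opprK addrC; congr (f _ - f _).
  by have := ltn_ord j; lia.
rewrite (big_ord_widen_cond x xpredT (fun j => f (x - j + (size la).+1)%N - f (x - j + size la)%N)) //.
rewrite [X in _ = _ + X]big_mkcond -big_split /=; apply: eq_bigr => j _.
rewrite /conj_part -cats1 count_cat /= addn0; case: ltnP => jy; last by rewrite addn0 addr0.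
have -> : count (fun k => (j < k)%N) la = size la.
  by apply/eqP; rewrite -all_count; apply: sub_all la_y => k /=; apply: leq_trans.
by rewrite addn1 addrC subrK.
Qed.

Definition hook_sum (f : nat -> rat) la := \sum_(u <- squares la) f (hook_length la u).

Lemma hook_sum_rows f la : pairwise geq la ->
  hook_sum f la = \sum_(i < size la) \sum_(s < beta (size la) la i) f s.+1
    - \sum_(i < size la) \sum_(j < size la | (i < j)%N)
        f (nth 0 la i - nth 0 la j + (j - i))%N.
Proof.
rewrite /hook_sum /squares; elim: la => [|x la IH] la_dec.
  by rewrite big_nil !big_ord0 subr0.
have [la_x la_dec'] : all (geq x) la /\ pairwise geq la by apply/andP; move: la_dec.
have conjS j : (j < x)%N -> conj_part (x :: la) j = (conj_part la j).+1.
  by rewrite /conj_part /= => ->.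
rewrite big_allpairs_dep /= big_cons -[1%N]addn0 iotaDl big_map.
have -> : \sum_(j <- iota 0 x) f (hook_length (x :: la) (0, j))
    = \sum_(j < x) f (x - j + conj_part la j)%N.
  rewrite -{1}[x]subn0 -/(index_iota 0 x) big_mkord; apply: eq_bigr => j _.
  by congr f; rewrite /hook_length conjS //= ; have := ltn_ord j; lia.
have -> : \sum_(i <- iota 0 (size la)) \sum_(j <- iota 0 (nth 0 (x :: la) (1 + i)))
      f (hook_length (x :: la) (1 + i, j)%N)
    = \sum_(u <- squares la) f (hook_length la u).
  rewrite [RHS]big_allpairs_dep; apply: eq_big_seq => i; rewrite mem_iota add1n => /= isz.
  apply: eq_big_seq => j; rewrite mem_iota /= => jla; congr f.
  rewrite /hook_length conjS; last first.
    by apply: leq_trans jla _; apply: (allP la_x); apply: mem_nth.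
  by rewrite /=; lia.
rewrite IH // !big_ord_recl /=.
have -> : \sum_(j < (size la).+1 | (0 < j)%N) f (x - nth 0 (x :: la) j + (j - 0))%N
    = \sum_(i < size la) f (x - nth 0 la i + i.+1)%N.
  by rewrite big_mkcond big_ord_recl /= add0r; apply: eq_bigr => i _; rewrite subn0.
have -> : beta (size la).+1 (x :: la) 0 = (x + size la)%N.
  by rewrite /beta subn1.
rewrite -first_row_hooks //.
have -> : \sum_(i < size la) \sum_(s < beta (size la).+1 (x :: la) (lift ord0 i)) f s.+1
    = \sum_(i < size la) \sum_(s < beta (size la) la i) f s.+1 by [].
have -> : \sum_(i < size la) \sum_(j < (size la).+1 | (lift ord0 i < j)%N)
      f (nth 0 la i - nth 0 (x :: la) j + (j - lift ord0 i))%N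
    = \sum_(i < size la) \sum_(j < size la | (i < j)%N)
        f (nth 0 la i - nth 0 la j + (j - i))%N.
  apply: eq_bigr => i _; rewrite big_mkcond big_ord_recl /= add0r [RHS]big_mkcond.
  by apply: eq_bigr.
ring.
Qed.

(** Applied to empty rows, the formula for hook sums evaluates the terms that
    depend on the number of rows only. *)
Lemma hook_sum_vacuum f N : hook_sum f (nseq N 0%N) = 0.
Proof.
rewrite /hook_sum big1_seq // => u /=; rewrite mem_squares nth_nseq.
by case: ifP; rewrite ltn0.
Qed.

Lemma sum_lt_even N (a : 'I_N -> rat) k : (0 < k)%N ->
  2 * \sum_(i < N) \sum_(j < N | (i < j)%N) (a i - a j) ^+ (k.*2)
    = \sum_(i < N) \sum_(j < N) (a i - a j) ^+ (k.*2).
Proof.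
move=> k0; have sym i j : (a i - a j) ^+ k.*2 = (a j - a i) ^+ k.*2.
  by rewrite -opprB exprNn -signr_odd odd_double mul1r.
have -> : \sum_(i < N) \sum_(j < N) (a i - a j) ^+ k.*2
    = \sum_(i < N) \sum_(j < N | (i < j)%N) (a i - a j) ^+ k.*2
      + \sum_(i < N) \sum_(j < N | (j < i)%N) (a i - a j) ^+ k.*2.
  rewrite -big_split; apply: eq_bigr => i _ /=.
  rewrite (bigID (fun j : 'I_N => (i < j)%N)) /=; congr (_ + _).
  rewrite big_mkcond [RHS]big_mkcond; apply: eq_bigr => j _.
  case: (ltngtP i j) => // /val_inj ->.
  by rewrite subrr expr0n -leqn0 leqNgt double_gt0 k0.
rewrite mulr2n mulrDl !mul1r; congr (_ + _).
rewrite (exchange_big_dep predT) //=.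
by apply: eq_bigr => i _; apply: eq_bigr => j _; apply: sym.
Qed.

Lemma hook_power_rows k Q la : (0 < k)%N ->
  (forall z : rat, Q.[z + 1] - Q.[z] = z ^+ k.*2) -> pairwise geq la ->
  2 * hook_sum (fun s => s%:R ^+ k.*2) la
    = 2 * \sum_(i < size la) (Q.[row_content la i + (size la)%:R] - Q.[1])
      - \sum_(i < size la) \sum_(j < size la) (row_content la i - row_content la j) ^+ k.*2.
Proof.
move=> k0 QE la_dec; rewrite hook_sum_rows // mulrBr; congr (2 * _ - _).
  apply: eq_bigr => i _; rewrite -[row_content _ _ + _](subrK 1) -betaE //.
  elim: (beta _ _ _) => [|b IH]; first by rewrite big_ord0 add0r subrr.
  by rewrite big_ord_recr /= IH -(natr1 b) -QE; ring.
rewrite -sum_lt_even //; congr (2 * _).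
apply: eq_bigr => i _; apply: eq_bigr => j ij; congr (_ ^+ _).
have le : (nth 0%N la j <= nth 0%N la i)%N.
  by have /(pairwiseP 0%N)/(_ i j (ltn_ord i) (ltn_ord j) ij) := la_dec.
by rewrite natrD !natrB // 1?ltnW // /row_content; ring.
Qed.

(** Let a_i be the contents after the rows, v_i = - i their values for empty
    rows and m = 2k.  The double sum of (a_i - a_j)^m - (v_i - v_j)^m splits
    into a part bilinear in the differences between a and v, which expands
    into products of the [row_psum r], and into twice the sum of the
    (a_i - v_j)^m - (v_i - v_j)^m.  Since the v_j are consecutive integers, the
    latter telescopes to values of Q, whose N-dependent part cancels that of
    the single sum. *)
Lemma hook_power_sum_row_psum k Q n la : (0 < k)%N ->
  (forall z : rat, Q.[z + 1] - Q.[z] = z ^+ k.*2) -> is_partition n la ->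
  2 * hook_sum (fun s => s%:R ^+ k.*2) la
    = 2 * \sum_(i < size la) (Q.[row_content la i] - Q.[- i%:R])
      - \sum_(r < k.*2.+1) (-1) ^+ r * 'C(k.*2, r)%:R
          * (row_psum (k.*2 - r) la * row_psum r la).
Proof.
move=> k0 QE Pla; set N := size la; set m := k.*2.
pose a (i : 'I_N) := row_content la i; pose v (i : 'I_N) : rat := - i%:R.
have vE i : row_content (nseq N 0%N) i = - i%:R.
  by rewrite /row_content nth_nseq if_same sub0r.
have la_dec : pairwise geq la.
  case/and3P: Pla => + _ _; rewrite sorted_pairwise // => x y z /= yx zy.
  exact: leq_trans zy yx.
have Hla := hook_power_rows k0 QE la_dec.
have H0 : 0 = 2 * \sum_(i < N) (Q.[v i + N%:R] - Q.[1])
    - \sum_(i < N) \sum_(j < N) (v i - v j) ^+ m.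
  have vac : pairwise geq (nseq N 0%N).
    by apply/(pairwiseP 0%N) => i j _ _ _; rewrite !nth_nseq !if_same.
  have := hook_power_rows k0 QE vac; rewrite hook_sum_vacuum mulr0 size_nseq => H; rewrite [LHS]H.
  congr (2 * _ - _); apply: eq_bigr => i _; first by rewrite vE.
  by apply: eq_bigr => j _; rewrite !vE.
have sym (x y : rat) : (x - y) ^+ m = (y - x) ^+ m.
  by rewrite -opprB exprNn -signr_odd odd_double mul1r.
have exprB (x y : rat) : (x - y) ^+ m
    = \sum_(r < m.+1) (-1) ^+ r * 'C(m, r)%:R * (x ^+ (m - r) * y ^+ r).
  by rewrite exprBn; apply: eq_bigr => r _; rewrite -mulr_natl; ring.
have T z : \sum_(j < N) (z - v j) ^+ m = Q.[z + N%:R] - Q.[z].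
  rewrite /v; elim: (N) => [|M IH]; first by rewrite big_ord0 addr0 subrr.
  rewrite big_ord_recr /= IH opprK; have := QE (z + M%:R).
  by rewrite -addrA natr1 => <-; ring.
have psums : \sum_(r < m.+1) (-1) ^+ r * 'C(m, r)%:R * (row_psum (m - r) la * row_psum r la)
    = \sum_(i < N) \sum_(j < N) ((a i - a j) ^+ m - (a i - v j) ^+ m
        - (v i - a j) ^+ m + (v i - v j) ^+ m).
  under eq_bigr => r _ do rewrite /row_psum big_distrlr mulr_sumr /=.
  rewrite exchange_big /=; apply: eq_bigr => i _.
  under eq_bigr => r _ do rewrite mulr_sumr /=.
  rewrite exchange_big /=; apply: eq_bigr => j _.
  rewrite !exprB -!sumrB -big_split /=; apply: eq_bigr => r _.
  by rewrite /a /v; ring.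
rewrite Hla psums -/N -/m.
have -> : \sum_(i < N) \sum_(j < N) ((a i - a j) ^+ m - (a i - v j) ^+ m
        - (v i - a j) ^+ m + (v i - v j) ^+ m)
    = \sum_(i < N) \sum_(j < N) (a i - a j) ^+ m
      + \sum_(i < N) \sum_(j < N) (v i - v j) ^+ m
      - 2 * \sum_(i < N) (Q.[a i + N%:R] - Q.[a i]).
  have -> : \sum_(i < N) (Q.[a i + N%:R] - Q.[a i]) = \sum_(i < N) \sum_(j < N) (a i - v j) ^+ m.
    by apply: eq_bigr => i _; rewrite T.
  have VA : \sum_(i < N) \sum_(j < N) (v i - a j) ^+ m
      = \sum_(i < N) \sum_(j < N) (a i - v j) ^+ m.
    by rewrite exchange_big; apply: eq_bigr => i _; apply: eq_bigr => j _; apply: sym.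
  under eq_bigr => i _ do rewrite big_split /= !sumrB.
  by rewrite big_split /= !sumrB VA; ring.
have S0 : \sum_(i < N) \sum_(j < N) (v i - v j) ^+ m
   = \sum_(i < N) (Q.[v i + N%:R] - Q.[v i]).
  by apply: eq_bigr => i _; rewrite T.
rewrite S0 in H0 *; rewrite !sumrB in H0 *; rewrite /a /v in H0 *; lra.
Qed.

Definition shifted_sym (g : seq nat -> rat) : Prop :=
  exists d h, wpoly d h /\ forall n la, is_partition n la -> g la = h la.

Lemma shifted_sym_hook_power k : (0 < k)%N ->
  shifted_sym (hook_sum (fun s => s%:R ^+ k.*2)).
Proof.
move=> k0; have [Q QE] := antidifference 'X^(k.*2).
have {}QE (z : rat) : Q.[z + 1] - Q.[z] = z ^+ k.*2 by rewrite QE hornerXn.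
pose D := (maxn (size Q) (k.*2).+2).*2.
(* D is a crude bound for the weights of both sums. *)
exists D, (fun la => \sum_(l < size Q) Q`_l * row_psum l la
  + - 2^-1 * \sum_(r < k.*2.+1) ((-1) ^+ r * 'C(k.*2, r)%:R)
          * (row_psum (k.*2 - r) la * row_psum r la)); split.
  apply: wpoly_add.
    by apply: wpoly_sum => l _; apply/wpoly_scale/wpoly_psum; have := ltn_ord l; rewrite /D; lia.
  apply/wpoly_scale/wpoly_sum => r _; apply: wpoly_scale.
  apply: (@wpoly_le (k.*2.+1 + k.*2.+1)); first by rewrite /D; lia.
  by apply: wpoly_mul; apply: wpoly_psum; have := ltn_ord r; lia.
move=> n la Pla; have := hook_power_sum_row_psum k0 QE Pla.
have -> : \sum_(i < size la) (Q.[row_content la i] - Q.[- i%:R])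
    = \sum_(l < size Q) Q`_l * row_psum l la.
  under eq_bigr => i _ do rewrite !horner_coef -sumrB.
  rewrite exchange_big; apply: eq_bigr => l _; rewrite mulr_sumr.
  by apply: eq_bigr => i _; rewrite -mulrBr.
move=> E; apply: (@mulfI _ 2); first by [].
by rewrite E; field.
Qed.

(** * Symmetric functions as polynomials in power sums *)

(** The augmented monomial symmetric polynomial of exponents r 0, ..., r (k-1):
    the sum over ordered choices of distinct variables. *)
Definition aug_monomial (a : seq rat) k (r : nat -> nat) : rat :=
  \sum_(t : k.-tuple 'I_(size a) | uniq t) \prod_(j < k) a`_(tnth t j) ^+ r j.

Lemma sum_tuple_cons (I : finType) k (P : pred (k.+1.-tuple I)) (G : k.+1.-tuple I -> rat) :
  \sum_(t | P t) G t
    = \sum_(i : I) \sum_(t : k.-tuple I | P [tuple of i :: t]) G [tuple of i :: t].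
Proof.
rewrite pair_big_dep /=.
rewrite (reindex (fun p : I * k.-tuple I => [tuple of p.1 :: p.2])) //=.
exists (fun t : k.+1.-tuple I => (thead t, [tuple of behead t])) => [[i t] _|t _] /=.
  by congr pair; apply: val_inj.
by rewrite -tuple_eta.
Qed.

(** In the product of a power sum with an augmented monomial, the variable from
    the power sum is either a new one or equal to exactly one of those in the
    monomial, whose exponent then grows. *)
Lemma aug_monomialS a k (r : nat -> nat) :
  aug_monomial a k.+1 r
    = (\sum_(i < size a) a`_i ^+ r 0%N) * aug_monomial a k (fun j => r j.+1)
      - \sum_(l < k) aug_monomial a k (fun j => (r j.+1 + (j == l) * r 0)%N).
Proof.
pose P (t : k.-tuple 'I_(size a)) := \prod_(j < k) a`_(tnth t j) ^+ r j.+1.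
have -> : aug_monomial a k.+1 r
    = \sum_(i < size a) \sum_(t : k.-tuple 'I_(size a) | uniq t && (i \notin t))
        a`_i ^+ r 0%N * P t.
  rewrite /aug_monomial sum_tuple_cons; apply: eq_bigr => i _.
  apply: eq_big => [t|t _]; first by rewrite /= andbC.
  rewrite big_ord_recl tnth0; congr (_ * _).
  by apply: eq_bigr => j _; rewrite tnthS.
apply/esym/eqP; rewrite subr_eq; apply/eqP.
have -> : \sum_(l < k) aug_monomial a k (fun j => (r j.+1 + (j == l) * r 0)%N)
    = \sum_(i < size a) \sum_(t : k.-tuple 'I_(size a) | uniq t && (i \in t))
        a`_i ^+ r 0%N * P t.
  rewrite exchange_big (exchange_big_dep (fun t : k.-tuple 'I_(size a) => uniq t)) /=; last first.
    by move=> i t _ /andP[].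
  apply: eq_bigr => t t_uniq.
  rewrite (eq_bigl (mem t)) => [|i]; last by rewrite t_uniq.
  rewrite -big_uniq // big_tuple; apply: eq_bigr => l _.
  under eq_bigr => j _ do rewrite exprD.
  rewrite big_split mulrC /=; congr (_ * _).
  rewrite (bigD1 l) //= eqxx mul1n big1 ?mulr1 // => j jl.
  by rewrite val_eqE (negPf jl).
rewrite mulr_suml -big_split /=; apply: eq_bigr => i _.
rewrite addrC mulr_sumr (bigID (fun t : k.-tuple _ => i \in t)) /=.
by congr (_ + _).
Qed.

(** Closure conditions instead of polynomial expressions: the argument applies
    to any algebra C of functions that contains the power sums of the family A
    of variables. *)
Section PowerSumGeneration.
Variables (T : Type) (A : T -> seq rat) (C : (T -> rat) -> Prop).
Hypothesis C_const : forall c, C (fun=> c).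
Hypothesis C_add : forall g h, C g -> C h -> C (fun x => g x + h x).
Hypothesis C_mul : forall g h, C g -> C h -> C (fun x => g x * h x).
Hypothesis C_ext : forall g h, C g -> g =1 h -> C h.
Hypothesis C_psum : forall k, (0 < k)%N -> C (fun x => \sum_(i < size (A x)) (A x)`_i ^+ k).

Lemma C_sum (I : Type) (r : seq I) (P : pred I) (g : I -> T -> rat) :
  (forall i, P i -> C (g i)) -> C (fun x => \sum_(i <- r | P i) g i x).
Proof.
move=> Cg; elim: r => [|i r IH].
  by apply: C_ext (C_const 0) _ => x; rewrite big_nil.
case Pi: (P i); last by apply: C_ext IH _ => x; rewrite big_cons Pi.
by apply: C_ext (C_add (Cg _ Pi) IH) _ => x; rewrite big_cons Pi.
Qed.

Lemma C_aug_monomial k r : (forall j, (j < k)%N -> (0 < r j)%N) ->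
  C (fun x => aug_monomial (A x) k r).
Proof.
elim: k r => [|k IH] r r_gt0.
  apply: C_ext (C_const 1) _ => x; rewrite /aug_monomial (big_pred1 [tuple]).
    by rewrite big_ord0.
  by move=> t; rewrite [t]tuple0.
pose g1 x := (\sum_(i < size (A x)) (A x)`_i ^+ r 0%N) * aug_monomial (A x) k (fun j => r j.+1).
pose g2 x := \sum_(l < k) aug_monomial (A x) k (fun j => (r j.+1 + (j == l) * r 0)%N).
apply: (@C_ext (fun x => g1 x + -1 * g2 x)); last first.
  by move=> x; rewrite aug_monomialS mulN1r.
apply: C_add; first by apply: C_mul; [apply: C_psum; apply: r_gt0|apply: IH => j jk; apply: r_gt0].
apply: C_mul => //; apply: C_sum => l _; apply: IH => j jk.
by rewrite addn_gt0 r_gt0.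
Qed.

End PowerSumGeneration.

Definition monom_of N (f : nat -> nat) : monom :=
  [fsfun i in [fset j in iota 0 N]%fset => f i].

Lemma monom_ofE N f i : monom_of N f i = if (i < N)%N then f i else 0%N.
Proof. by rewrite fsfun_fun !inE mem_iota. Qed.

Definition exponent N d (e : {ffun 'I_N -> 'I_d}) (i : nat) : nat :=
  if insub i is Some x then e x else 0%N.

Lemma exponent_ord N d (e : {ffun 'I_N -> 'I_d}) (i : 'I_N) : exponent e i = e i.
Proof. by rewrite /exponent valK. Qed.

Lemma big_finsupp (R : Type) (idx : R) (op : Monoid.com_law idx) (G : nat -> R)
    N (m : monom) :
  (forall i, (N <= i)%N -> m i = 0%N) -> (forall i, m i = 0%N -> G i = idx) ->
  \big[op/idx]_(i <- finsupp m) G i = \big[op/idx]_(i < N) G i.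
Proof.
move=> mN G0; rewrite -(big_mkord xpredT G) /index_iota subn0.
rewrite (bigID (fun i => m i == 0%N)) /= big1 ?Monoid.mul1m; last first.
  by move=> i /eqP; apply: G0.
rewrite [RHS](bigID (fun i => m i == 0%N)) /= [X in op X _]big1 ?Monoid.mul1m; last first.
  by move=> i /eqP; apply: G0.
rewrite -big_filter -[RHS]big_filter; apply/perm_big/uniq_perm.
- exact/filter_uniq/fset_uniq.
- exact/filter_uniq/iota_uniq.
move=> i; rewrite !mem_filter mem_finsupp mem_iota /= add0n.
case: (ltnP i N) => [_|/mN ->]; last by rewrite eqxx.
by case: (m i == 0%N).
Qed.

Lemma perm_iota_bij n (s : seq nat) : perm_eq s (iota 0 n) ->
  bijective (fun i => if (i < n)%N then nth 0%N s i else i).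
Proof.
move=> s_perm; have s_uniq : uniq s by rewrite (perm_uniq s_perm) iota_uniq.
have mem_s i : (i \in s) = (i < n)%N by rewrite (perm_mem s_perm) mem_iota.
have size_s : size s = n by rewrite (perm_size s_perm) size_iota.
exists (fun i => if (i < n)%N then index i s else i) => i /=.
  case: (ltnP i n) => [lt|le]; last by rewrite ltnNge le.
  by rewrite -mem_s mem_nth ?size_s // index_uniq ?size_s.
case: (ltnP i n) => [lt|le]; last by rewrite ltnNge le.
by rewrite -{1}size_s index_mem mem_s lt nth_index ?mem_s.
Qed.

(** The variables t_0, ..., t_(k-1) that occur in the monomial can be moved to
    the first k positions: listing t first and the remaining indices below n
    next, and fixing all other indices, gives a bijection of nat. *)
Lemma permutation_invariant_monom_of F n k (t : k.-tuple 'I_n) (f : nat -> nat) :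
  permutation_invariant F -> uniq t -> (forall i : 'I_n, i \notin t -> f i = 0%N) ->
  F (monom_of k (fun j => f (nth 0%N (map val t) j))) = F (monom_of n f).
Proof.
move=> hF t_uniq f0; set u := map val t.
have u_uniq : uniq u by rewrite map_inj_uniq //; apply: val_inj.
have size_u : size u = k by rewrite size_map size_tuple.
have u_lt i : i \in u -> (i < n)%N by case/mapP => x _ ->; apply: ltn_ord.
(* u is t as a list of numbers; s lists all indices below n, starting with u. *)
pose s := u ++ [seq i <- iota 0 n | i \notin u].
have s_perm : perm_eq s (iota 0 n).
  apply: uniq_perm; rewrite ?iota_uniq //.
    rewrite cat_uniq u_uniq filter_uniq ?iota_uniq // andbT /=.
    by apply/hasPn => i; rewrite mem_filter => /andP[].
  move=> i; rewrite mem_cat mem_filter mem_iota /=.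
  by case: (boolP (i \in u)) => // /u_lt ->.
have size_s : size s = n by rewrite (perm_size s_perm) size_iota.
apply: hF (perm_iota_bij s_perm) _ _ _ => i; rewrite !monom_ofE.
have kn : (k <= n)%N by rewrite -size_s size_cat size_u leq_addr.
case: (ltnP i n) => [lt|le]; last by rewrite !ltnNge le (leq_trans kn le).
have si : nth 0%N s i \in s by rewrite mem_nth ?size_s.
have si_lt : (nth 0%N s i < n)%N by move: si; rewrite (perm_mem s_perm) mem_iota.
rewrite si_lt; case: ltnP => ik; first by rewrite /s nth_cat size_u ik.
have : nth 0%N s i \notin u.
  rewrite /s nth_cat size_u ltnNge ik /=.
  have : nth 0%N [seq i <- iota 0 n | i \notin u] (i - k) \in [seq i <- iota 0 n | i \notin u].
    by rewrite mem_nth // ltn_subLR // -size_u -size_cat size_s.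
  by rewrite mem_filter => /andP[].
move=> nu; rewrite -[nth _ _ _]/(val (Ordinal si_lt)) f0 //.
by apply: contra nu => /(map_f val).
Qed.

Section Substitution.
Variables (F : powser) (d : nat) (a : seq rat).
Hypothesis F_bound : forall m : monom, (d < mdegree m)%N -> F m = 0.
Hypothesis F_sym : permutation_invariant F.

Let n := size a.
Let W (e : {ffun 'I_n -> 'I_d.+1}) :=
  F (monom_of n (exponent e)) * \prod_(i < n) a`_i ^+ e i.
Let fsupp N (e : {ffun 'I_N -> 'I_d.+1}) := [set i | e i != ord0]%SET.

Lemma leq_mdegree (m : monom) i : (m i <= mdegree m)%N.
Proof.
rewrite /mdegree; case: (finsuppP m i) => [//|im].
by rewrite (bigD1_seq i) ?fset_uniq //= leq_addr.
Qed.

(** The only monomials that contribute involve the variables of index below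
    size a, and have exponents at most d. *)
Lemma psubst_ffun : psubst F a = \sum_e W e.
Proof.
rewrite /psubst.
have mono_inj : injective (fun e : {ffun 'I_n -> 'I_d.+1} => monom_of n (exponent e)).
  move=> e e' /fsfunP E; apply/ffunP => i; apply: val_inj.
  by have := E i; rewrite !monom_ofE ltn_ord !exponent_ord.
rewrite (@fsbigE _ _ _ _ _ [seq monom_of n (exponent e) | e <- enum {ffun 'I_n -> 'I_d.+1}]).
- rewrite big_map big_mkcond /= big_enum /=; apply: eq_bigr => e _.
  rewrite in_setT; congr (_ * _).
  rewrite (@big_finsupp _ _ _ _ n) => [|i le|i ->]; rewrite ?expr0 //.
    by apply: eq_bigr => i _; rewrite monom_ofE ltn_ord exponent_ord.
  by rewrite monom_ofE ltnNge le.
- by rewrite map_inj_uniq ?enum_uniq.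
- by [].
move=> m _ mL; apply/eqP; apply: contraNT mL; rewrite mulf_eq0 negb_or => /andP[Fm am].
have md i : (m i < d.+1)%N.
  rewrite ltnS; apply: leq_trans (leq_mdegree _ _) _; rewrite leqNgt.
  by apply: contra Fm => /F_bound ->.
have mn i : (n <= i)%N -> m i = 0%N.
  move=> le; apply/eqP; apply: contraNT am => mi.
  have im : i \in finsupp m by rewrite mem_finsupp.
  rewrite (bigD1_seq i) ?fset_uniq //= nth_default // expr0n.
  by rewrite (negPf mi) mul0r.
apply/mapP; exists [ffun i : 'I_n => inord (m i)]; first by rewrite mem_enum.
apply/fsfunP => i; rewrite monom_ofE; case: ltnP => [lt|/mn //].
by rewrite -[i]/(val (Ordinal lt)) exponent_ord ffunE inordK.
Qed.

Lemma W_eq0 e : (d < #|fsupp e|)%N -> W e = 0.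
Proof.
move=> de; rewrite /W F_bound ?mul0r //; apply: leq_trans de _.
rewrite /mdegree (@big_finsupp _ _ _ _ n) // => [|i le]; last first.
  by rewrite monom_ofE ltnNge le.
rewrite -sum1_card big_mkcond; apply: leq_sum => i _.
by rewrite monom_ofE ltn_ord exponent_ord inE; case: ifP => //; rewrite lt0n.
Qed.

(** A monomial whose variables are the entries of t is determined by the
    exponents read along t, and by symmetry its coefficient depends on those
    exponents only. *)
Lemma sum_W_support k (t : k.-tuple 'I_n) : uniq t ->
  \sum_(e | fsupp e == [set x in t]%SET) W e
    = \sum_(r : {ffun 'I_k -> 'I_d.+1} | [forall j, r j != ord0])
        F (monom_of k (exponent r)) * \prod_(j < k) a`_(tnth t j) ^+ exponent r j.
Proof.
move=> t_uniq.
pose pull (e : {ffun 'I_n -> 'I_d.+1}) := [ffun j : 'I_k => e (tnth t j)].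
pose push (r : {ffun 'I_k -> 'I_d.+1}) : {ffun 'I_n -> 'I_d.+1} :=
  [ffun i => if [pick j | tnth t j == i] is Some j then r j else ord0].
have t_inj : injective (tnth t) by apply/tuple_uniqP.
have pushK r j : push r (tnth t j) = r j.
  by rewrite ffunE; case: pickP => [l /eqP/t_inj -> //|/(_ j)]; rewrite eqxx.
have push0 r i : i \notin t -> push r i = ord0.
  rewrite ffunE; case: pickP => // j /eqP <-; by rewrite mem_tnth.
rewrite [RHS](reindex_onto pull push) /=; last first.
  by move=> r _; apply/ffunP => j; rewrite ffunE pushK.
apply: eq_big => [e|e /eqP supp_e].
  apply/eqP/andP => [supp_e|[/forallP e_pos /eqP eK]].
    have e_in i : (e i != ord0) = (i \in t).
      by have /setP/(_ i) := supp_e; rewrite !inE.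
    split; first by apply/forallP => j; rewrite ffunE e_in mem_tnth.
    apply/eqP/ffunP => i; case: (boolP (i \in t)) => [/tnthP[j ->]|it].
      by rewrite pushK ffunE.
    by rewrite push0 //; apply/esym/eqP; move: it; rewrite -e_in negbK.
  apply/finset.setP => i; rewrite !inE; case: (boolP (i \in t)) => [/tnthP[j ->]|it].
    by have := e_pos j; rewrite ffunE.
  by rewrite -eK push0 ?eqxx.
have e0 (i : 'I_n) : i \notin t -> e i = ord0.
  by move=> it; have /setP/(_ i) := supp_e; rewrite !inE (negPf it) => /negbFE/eqP.
rewrite /W; congr (_ * _).
  rewrite -(permutation_invariant_monom_of F_sym t_uniq) => [|i it]; last first.
    by rewrite exponent_ord e0.
  congr F; apply/fsfunP => j; rewrite !monom_ofE; case: ltnP => // jk.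
  rewrite -[j]/(val (Ordinal jk)) exponent_ord ffunE (nth_map (tnth t (Ordinal jk))) ?size_tuple //.
  by rewrite -tnth_nth exponent_ord.
rewrite (bigID (mem t)) /= [X in _ * X]big1 ?mulr1 => [|i it]; last by rewrite e0 ?expr0.
rewrite -big_uniq // big_tuple; apply: eq_bigr => j _.
by rewrite exponent_ord ffunE.
Qed.

(** A monomial in exactly k variables is counted once for each of the k!
    orderings of these variables.  The index set of the sum and the
    coefficients depend on d and F but not on a. *)
Lemma psubst_aug_monomial :
  psubst F a = \sum_(k < d.+1)
    \sum_(r : {ffun 'I_k -> 'I_d.+1} | [forall j, r j != ord0])
      (k`!%:R^-1 * F (monom_of k (exponent r))) * aug_monomial a k (exponent r).
Proof.
have inner k : \sum_(r : {ffun 'I_k -> 'I_d.+1} | [forall j, r j != ord0])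
      (k`!%:R^-1 * F (monom_of k (exponent r))) * aug_monomial a k (exponent r)
    = \sum_(e | #|fsupp e| == k) W e.
  under eq_bigr => r _ do rewrite -mulrA /aug_monomial mulr_sumr.
  rewrite -mulr_sumr exchange_big /=.
  under eq_bigr => t t_uniq do rewrite -sum_W_support //.
  rewrite (exchange_big_dep predT) //= [in RHS]big_mkcond mulr_sumr.
  apply: eq_bigr => e _; rewrite sumr_const.
  have -> : #|[pred t : k.-tuple 'I_n | uniq t && (fsupp e == [set x in t]%SET)]|
      = if #|fsupp e| == k then k`! else 0%N.
    case: eqP => [cardS|cardS]; last first.
      apply/eqP/pred0P => t /=; apply/negP => /andP[t_uniq /eqP supp_e].
      by apply: cardS; rewrite supp_e cardsE (card_uniqP t_uniq) size_tuple.
    have <- : #|fsupp e| ^_ k = k`! by rewrite cardS ffactnn.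
    rewrite -card_uniq_tuples; apply: eq_card => t; rewrite !inE andbC.
    apply: andb_id2r => t_uniq; apply/eqP/allP => [supp_e i it|sub].
      by rewrite -[_ i]/(i \in fsupp e) supp_e inE.
    apply/esym/eqP; rewrite eqEcard cardS cardsE (card_uniqP t_uniq) size_tuple leqnn andbT.
    by apply/fintype.subsetP => i; rewrite inE; apply: sub.
  case: ifP => _; last by rewrite mulr0.
  by rewrite -[W e *+ _]mulr_natl mulKf // pnatr_eq0 -lt0n fact_gt0.
under eq_bigr => k _ do rewrite inner.
rewrite psubst_ffun (exchange_big_dep predT) //=; apply: eq_bigr => e _.
have [le|lt] := leqP #|fsupp e| d.
  by rewrite (big_pred1 (Ordinal (le : (_ < d.+1)%N))).
by rewrite big1 => // *; rewrite W_eq0.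
Qed.

End Substitution.

(** * The polynomiality theorem *)

(** Shifted symmetric functions form an algebra which contains the power sums of
    the squared hook lengths, so that it contains every combination of
    augmented monomials in them. *)
Lemma shifted_sym_psubst (F : powser) : symmetric_functions F ->
  shifted_sym (fun la => psubst F (hook_squares la)).
Proof.
case=> -[d F_bound] F_sym.
have C_add g h : shifted_sym g -> shifted_sym h -> shifted_sym (fun la => g la + h la).
  move=> [d1 [g1 [gd gE]]] [d2 [h1 [hd hE]]].
  exists (maxn d1 d2), (fun la => g1 la + h1 la); split.
    by apply: wpoly_add; [apply: wpoly_le gd; apply: leq_maxl|apply: wpoly_le hd; apply: leq_maxr].
  by move=> n la Pla; rewrite (gE _ _ Pla) (hE _ _ Pla).
have C_mul g h : shifted_sym g -> shifted_sym h -> shifted_sym (fun la => g la * h la).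
  move=> [d1 [g1 [gd gE]]] [d2 [h1 [hd hE]]].
  exists (d1 + d2)%N, (fun la => g1 la * h1 la); split; first exact: wpoly_mul.
  by move=> n la Pla; rewrite (gE _ _ Pla) (hE _ _ Pla).
have C_const c : shifted_sym (fun=> c).
  by exists 0%N, (fun=> c); split=> //; apply: wpoly_const.
have C_ext g h : shifted_sym g -> g =1 h -> shifted_sym h.
  by move=> [e [g1 [gd gE]]] gh; exists e, g1; split=> // n la Pla; rewrite -gh (gE _ _ Pla).
have C_psum k : (0 < k)%N ->
    shifted_sym (fun la => \sum_(i < size (hook_squares la)) (hook_squares la)`_i ^+ k).
  move=> k_gt0; apply: C_ext (shifted_sym_hook_power k_gt0) _ => la.
  rewrite -(big_mkord xpredT (fun i => (hook_squares la)`_i ^+ k)).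
  rewrite -(big_nth 0 xpredT (fun x => x ^+ k)) big_map.
  by apply: eq_bigr => u _; rewrite -exprM mul2n.
have sum_closed := C_sum C_const C_add C_ext.
apply: (C_ext (fun la => \sum_(k < d.+1)
    \sum_(r : {ffun 'I_k -> 'I_d.+1} | [forall j, r j != ord0])
      (k`!%:R^-1 * F (monom_of k (exponent r))) * aug_monomial (hook_squares la) k (exponent r))).
  apply: (sum_closed) => k _; apply: (sum_closed) => r /forallP r_pos; apply: (C_mul) => //.
  apply: (C_aug_monomial C_const C_add C_mul C_ext C_psum) => j jk.
  by rewrite -[j]/(val (Ordinal jk)) exponent_ord lt0n; apply: r_pos.
by move=> la; rewrite (psubst_aug_monomial _ F_bound F_sym).
Qed.

Theorem theorem4p3 (F : powser) (hF : symmetric_functions F) :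
  exists P : {poly rat}, forall n : nat, Phi n F = P.[n%:R].
Proof.
have [d [h [hd hE]]] := shifted_sym_psubst hF.
have [P PE] := plancherel_polynomial hd.
exists P => n; rewrite -PE /Phi /plancherel div1r fsbig_partitions; congr (_ * _).
rewrite [LHS]big_seq [RHS]big_seq; apply: eq_bigr => la.
by rewrite mem_partitions => Pla; rewrite (hE _ _ Pla).
Qed.
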